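(* Let $\overline{M}$ be a smooth manifold with boundary, of dimension $n\ge2$, endowed with a smooth projective structure, and let $i:\partial M\hookrightarrow\overline{M}$ be the inclusion. Suppose that at every boundary point $\Pi^0_\mu\in\mathrm{span}(\mathrm{d}r)$ for all $1\le\mu\le n-1$, in some, and hence every, local boundary chart $(r,y^1,\dots,y^{n-1})$. Let $Q\hookrightarrow i^*P$ be the natural reduction of $i^*P$ to a principal $\tilde H$-bundle over $\partial M$ obtained by restricting to changes of coordinates between boundary charts of $\overline{M}$. Then pulling back the normal projective Cartan connection $\omega$ of $\overline{M}$ to $Q$ gives a Cartan geometry on $\partial M$ modeled on the non-effective Klein geometry $\tilde G/\tilde H$.
   Context: **Indices and charts.** A boundary chart is a chart $(U,(r,y^1,\dots,y^{n-1}))$ with $\partial M\cap U=\{r=0\}$ and $\mathrm{d}r\neq0$ on $\partial M\cap U$. Put $x^0=r$, $x^\mu=y^\mu$; Latin indices range over $0,\dots,n-1$, Greek over $1,\dots,n-1$; repeated indices are summed; round brackets denote symmetrisation. **Groups.** $Z=\{\lambda I_{n+1}:\lambda\ne0\}$, $G=\mathrm{PGL}(n;\mathbb R)=GL(n+1;\mathbb R)/Z$, and $H=\left\{\begin{pmatrix}A&0\\ \Upsilon&a\end{pmatrix}\right\}/Z\subset G$ with $A\in GL(n;\mathbb R)$. $G^2(\mathbb R^n)$ is the group of $2$-jets at $0$ of local diffeomorphisms of $\mathbb R^n$ fixing $0$, with elements $(u^i_j,u^i_{jk})$ (first and second derivatives); $H$ is identified with the subgroup $\{(A^i_j,-2A^i_{(j}\Upsilon_{k)})\}$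 (normalising $a=1$). The subgroups $$\tilde G=\left\{\begin{pmatrix}a&0&0\\ b&A&u\\ \beta&\delta&\gamma\end{pmatrix}\bmod Z:\ a\ne0,\ \begin{pmatrix}A&u\\ \delta&\gamma\end{pmatrix}\in GL(n;\mathbb R)\right\},\qquad \tilde H=\left\{\begin{pmatrix}a&0&0\\ b&A&0\\ \beta&\delta&\gamma\end{pmatrix}\bmod Z:\ a,\gamma\ne0,\ A\in GL(n-1;\mathbb R)\right\}\subset H$$ are written in blocks of size $1,n-1,1$, with $b\in\mathbb R^{n-1}$, $\beta\in\mathbb R$. $\tilde G$ is the stabiliser of the hyperplane $\{X_0=0\}$ of $\mathbb{RP}^n$ and $\tilde H$ is the stabiliser in $\tilde G$ of the point ${}^t(0,0_{\mathbb R^{n-1}},1)$. ''Non-effective'' means that $\tilde G$ does not act effectively on $\tilde G/\tilde H$. Lie algebras are denoted $\mathfrak g,\mathfrak h,\tilde{\mathfrak g},\tilde{\mathfrak h}$. **Frames and projective structures.** $P^2(\overline{M})$ is the bundle of $2$-frames: a $2$-frame at $x$ is the $2$-jet at $0$ of a local diffeomorphism $f$ from a neighbourhood of $0\in\mathbb R^n$ to a manifold without boundary into which a neighbourhood of $x$ is embedded, with $f(0)$ the image of $x$ (jets for different embeddings being identified when their Taylor coefficients are related by the chain rule). It is a principal $G^2(\mathbb R^n)$-bundle and a manifold with boundary, with canonical coordinates $(x^i,u^i_j,u^i_{jk})$ over a chart. A projective structure is a global section $s$ of $P^2(\overline{M})/H\to\overline{M}$; equivalently, a class of torsion-free affine connections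 modulo $\hat\nabla_XY=\nabla_XY+\Upsilon(X)Y+\Upsilon(Y)X$. It determines the principal $H$-bundle $P=\{q\in P^2(\overline{M}): q\bmod H=s(\pi(q))\}$. In a chart, if $\Gamma^i_{jk}$ are the Christoffel symbols of a connection in the class, the Thomas invariant is $\Pi^i_{jk}=\Gamma^i_{jk}-\frac1{n+1}\Gamma^l_{lk}\delta^i_j-\frac1{n+1}\Gamma^l_{lj}\delta^i_k$ (independent of the connection chosen), and $\Pi^i_j=\Pi^i_{jk}\,\mathrm{d}x^k$. The chart gives the local section $\sigma_x$ of $P$ with canonical coordinates $(x^i,\delta^i_j,-\Pi^i_{jk})$. **Cartan geometries.** A Cartan geometry on $N$ modeled on $G/H$ (any Lie group $G$ with closed subgroup $H$) is a principal $H$-bundle $P\to N$ with a $\mathfrak g$-valued $1$-form $\omega$ on $P$ such that $R_h^*\omega=\mathrm{Ad}_{h^{-1}}\omega$, $\omega(X^* )=X$ for fundamental vector fields $X^*$, $X\in\mathfrak h$, and each $\omega_p:T_pP\to\mathfrak g$ is a linear isomorphism. **Normal connection.** The normal projective Cartan connection $\omega$ on $P$ is the unique Cartan connection (modeled on $\mathrm{PGL}(n;\mathbb R)/H$) such that for every chart $$\sigma_x^*\omega=\begin{pmatrix}\Pi^i_j&\mathrm{d}x^i\\ -\tilde P_{kj}\,\mathrm{d}x^k&0\end{pmatrix},\qquad \tilde P_{lj}=\tfrac1{n-1}\tilde\Omega^i_j\!\left(\tfrac{\partial}{\partial x^i},\tfrac{\partial}{\partial x^l}\right),\qquad \tilde\Omega^i_j=\mathrm{d}\Pi^i_j+\Pi^i_k\wedge\Pi^k_j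 .$$ **The bundle $Q$.** For two boundary charts, the sections $\sigma_x,\sigma_{\bar x}$ are related along $\partial M$ by transition functions with values in $\tilde H$. $Q\subset i^*P=P|_{\partial M}$ is the principal $\tilde H$-subbundle which, over the domain of each boundary chart, is $\{\sigma_x(p)\cdot h: p\in\partial M\cap U,\ h\in\tilde H\}$. *)

(* Defs.v *)
From HB Require Import structures.
From mathcomp Require Export all_boot all_order all_algebra.
From mathcomp Require Export all_classical all_reals all_analysis.
Export numFieldNormedType.Exports.
Set Implicit Arguments.
Unset Strict Implicit.
Unset Printing Implicit Defensive.
Import Order.TTheory GRing.Theory Num.Theory.
Local Open Scope classical_set_scope.
Local Open Scope ring_scope.

(* Only used between finite-dimensional spaces, where this is the usual notion
   of a C^k map on an open set. *)
Fixpoint Ck (R : realType) (k : nat) (V W : normedModType R) (O : set V)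
    (f : V -> W) : Prop :=
  if k is k'.+1 then
    (forall x, O x -> differentiable f x) /\ (forall v, Ck k' O ('D_v f))
  else forall x, O x -> {for x, continuous f}.

Definition smooth (R : realType) (V W : normedModType R) (O : set V)
  (f : V -> W) : Prop := forall k, Ck k O f.

(* A set with partially defined coordinate systems. No axiom is imposed here:
   manifolds, and subsets of manifolds, are singled out by predicates below.
   [coord c] is only meaningful on [dom c]. *)
Record charted (R : realType) := Charted {
  pt :> Type;
  model : normedModType R;
  chart : Type;
  dom : chart -> set pt;
  coord : chart -> pt -> model }.
Arguments dom {R c} _ _.
Arguments coord {R c} _ _.
Arguments chart {R} _.
Arguments model {R} _.

Definition vect_charted (R : realType) (V : normedModType R) : charted R :=
  @Charted R V V unit (fun _ => setT) (fun _ v => v).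

Definition prod_charted (R : realType) (X Y : charted R) : charted R :=
  @Charted R (X * Y)%type (model X * model Y)%type (chart X * chart Y)%type
    (fun c => [set p | dom c.1 p.1 /\ dom c.2 p.2])
    (fun c p => (coord c.1 p.1, coord c.2 p.2)).

(* Smoothness, near p, of f restricted to an arbitrary subset A: in coordinates,
   f is locally the restriction of a smooth map on an open set. *)
Definition smooth_at (R : realType) (X Y : charted R) (A : set X) (f : X -> Y)
    (p : X) : Prop :=
  exists (c : chart X) (d : chart Y), [/\ dom c p, dom d (f p) &
    exists (O : set (model X)) (g : model X -> model Y),
      [/\ open O, O (coord c p), smooth O g &
        forall q, A q -> dom c q -> O (coord c q) ->
          dom d (f q) /\ coord d (f q) = g (coord c q)]].

Definition smooth_on (R : realType) (X Y : charted R) (A : set X) (f : X -> Y)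
  : Prop := forall p, A p -> smooth_at A f p.

Definition chart_nbhd (R : realType) (X : charted R) (p : X) (W : set X) : Prop :=
  exists (c : chart X) (O : set (model X)),
    [/\ dom c p, open O, O (coord c p)
      & W = [set q | dom c q /\ O (coord c q)]].

(* v is the velocity at time 0, in the chart c, of gam, a curve starting at p,
   smooth on some [0, e) with values in A. One-sided curves are used so that
   boundary points are treated like the others. *)
Definition velocity (R : realType) (X : charted R) (A : set X) (gam : R -> X)
    (p : X) (c : chart X) (v : model X) : Prop :=
  [/\ gam 0 = p, dom c p &
    exists (e : R) (g : R^o -> model X),
      [/\ 0 < e, smooth [set t : R^o | `|t| < e] g,
        (forall t : R, 0 <= t -> t < e ->
           [/\ A (gam t), dom c (gam t) & coord c (gam t) = g t])
        & v = derive1 g 0]].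

(* Tangent space of A at p, in the chart c: span of the velocities (which, at a
   boundary point, only fill a half-space). *)
Definition tangent (R : realType) (X : charted R) (A : set X) (p : X)
    (c : chart X) : set (model X) :=
  [set v | exists (k : nat) (a : 'I_k -> R) (w : 'I_k -> model X),
     (forall i, exists gam, velocity A gam p c (w i)) /\
     v = \sum_(i < k) a i *: w i].

Section Klein.
Variables (R : realType) (N : nat).
Implicit Types G H : set 'M[R]_N.

Definition matrix_subgroup G : Prop :=
  [/\ forall g, G g -> g \in unitmx,
      forall a : R, a != 0 -> G a%:M,
      forall g h, G g -> G h -> G (g *m h),
      forall g, G g -> G (invmx g) &
      forall g, closure G g -> g \in unitmx -> G g].

(* A set G of matrices stands for the Lie group G / Z, Z the nonzero scalars. *)
Definition klein_pair G H : Prop :=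
  [/\ matrix_subgroup G, matrix_subgroup H & H `<=` G].

(* gl(N) / R.1, the Lie algebra of GL(N) / Z, is identified with the
   trace-free matrices; this is the quotient map. *)
Definition mod_scalars (X : 'M[R]_N) : 'M[R]_N := X - (\tr X / N%:R)%:M.

Definition lie_algebra G : set 'M[R]_N :=
  mod_scalars @` @tangent R (vect_charted 'M[R]_N) G 1%:M tt.

(* (G / Z) / (H / Z) is acted upon effectively by G / Z. *)
Definition effective G H : Prop :=
  forall g, G g -> (forall k, G k -> H (invmx k *m g *m k)) ->
    exists a : R, g = a%:M.

End Klein.

Section Cartan.
Variables (R : realType) (N : nat) (X E : charted R).
Variables (pi : E -> X) (act : E -> 'M[R]_N -> E).
Variables (B : set X) (P : set E).
Let MN := vect_charted 'M[R]_N.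

(* pi : P -> B is a smooth principal bundle for the right action of H / Z. Near
   each point of B a section sig makes (y, h) |-> sig y . h a diffeomorphism
   onto P over W; the inverse into H / Z is required to lift smoothly to H near
   each point. In particular, P is a submanifold if B is. *)
Definition principal_bundle (H : set 'M[R]_N) : Prop :=
  [/\ forall q, P q -> B (pi q),
      forall q h, P q -> H h -> P (act q h) /\ pi (act q h) = pi q,
      forall q (a : R), P q -> a != 0 -> act q a%:M = q,
      forall q h k, P q -> H h -> H k -> act (act q h) k = act q (h *m k) &
      smooth_on P pi /\
      forall x, B x -> exists (W : set X) (sig : X -> E),
        [/\ chart_nbhd x W,
            forall y, W y -> B y -> P (sig y) /\ pi (sig y) = y,
            @smooth_on R (prod_charted X MN) E
              [set yh | [/\ W yh.1, B yh.1 & H yh.2]]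
              (fun yh => act (sig yh.1) yh.2),
            forall y h k, W y -> B y -> H h -> H k ->
              act (sig y) h = act (sig y) k -> exists a : R, k = a *: h &
            forall q0, P q0 -> W (pi q0) -> exists eta : E -> 'M[R]_N,
              @smooth_at R E MN (P `&` pi @^-1` W) eta q0 /\
              forall q, P q -> W (pi q) ->
                H (eta q) /\ q = act (sig (pi q)) (eta q)]].

(* A matrix-valued 1-form on P is given by its expressions in the charts of E:
   om q c v is its value on the vector at q with components v in the chart c,
   and is meaningful for v tangent to P only. Hence the pull-back of om to a
   subset Q of P is given by the same om, considered on Q. *)
Definition one_form (om : E -> chart E -> model E -> 'M[R]_N) : Prop :=
  [/\ forall q gam c c' v v', P q ->
        velocity P gam q c v -> velocity P gam q c' v' -> om q c v = om q c' v',
      forall q c, P q -> dom c q -> forall (a : R) v w,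
        tangent P q c v -> tangent P q c w ->
        om q c (a *: v + w) = a *: om q c v + om q c w &
      (* smoothness: restriction of a smooth 1-form of E, locally *)
      forall q c, P q -> dom c q ->
        exists (O : set (model E)) (Om : model E -> model E -> 'M[R]_N),
        [/\ open O, O (coord c q),
            forall v, smooth O (Om ^~ v),
            forall x (a : R) v w, Om x (a *: v + w) = a *: Om x v + Om x w &
            forall q', P q' -> dom c q' -> O (coord c q') ->
              forall v, tangent P q' c v -> om q' c v = Om (coord c q') v]].

Definition cartan_geometry (G H : set 'M[R]_N)
    (om : E -> chart E -> model E -> 'M[R]_N) : Prop :=
  [/\ klein_pair G H, principal_bundle H, one_form om &
    [/\ forall q h gam c v c' v', P q -> H h ->
          velocity P gam q c v ->
          velocity P (fun t => act (gam t) h) (act q h) c' v' ->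
          om (act q h) c' v' = invmx h *m om q c v *m h,
        (* the fundamental vector field of A takes the value (d/dt) q . h(t)
           at q, h being any curve of H issued from 1 with velocity A *)
        forall q h A c v, P q ->
          velocity (H : set MN) (h : R -> MN) 1%:M tt A ->
          velocity P (fun t => act q (h t)) q c v ->
          om q c v = mod_scalars A &
        forall q c, P q -> dom c q ->
          set_bij (tangent P q c) (lie_algebra G) (om q c)]].

End Cartan.

Section Charts.
Variables (R : realType) (m : nat) (M : topologicalType).

Definition half_space : set 'rV[R]_m.+1 := [set x | 0 <= x 0 ord0].

(* phi is a homeomorphism of U onto a relatively open set of the half-space *)
Definition topological_chart (U : set M) (phi : M -> 'rV[R]_m.+1) : Prop :=
  [/\ open U, {in U &, injective phi},
      forall O, open O -> open (U `&` phi @^-1` O) &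
      forall W, W `<=` U -> open W ->
        exists2 O, open O & phi @` W = O `&` half_space].

Definition smooth_transition (U : set M) (phi : M -> 'rV[R]_m.+1)
    (U' : set M) (phi' : M -> 'rV[R]_m.+1) : Prop :=
  forall p, U p -> U' p ->
    exists (O : set 'rV[R]_m.+1) (g : 'rV[R]_m.+1 -> 'rV[R]_m.+1),
      [/\ open O, O (phi p), smooth O g &
        forall q, U q -> U' q -> O (phi q) -> phi' q = g (phi q)].

End Charts.

(* Charts with values in the half-space; the dimension is m.+1. *)
Record bmanifold (R : realType) (m : nat) := BManifold {
  points :> topologicalType;
  points_hausdorff : hausdorff_space points;
  points_second_countable : @second_countable points;
  mchart : Type;
  mdom : mchart -> set points;
  mcoord : mchart -> points -> 'rV[R]_m.+1;
  mchart_cover : forall p, exists c, mdom c p;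
  mchart_top : forall c, topological_chart (mdom c) (mcoord c);
  mchart_smooth : forall c c',
    smooth_transition (mdom c) (mcoord c) (mdom c') (mcoord c');
  mchart_maximal : forall (U : set points) (phi : points -> 'rV[R]_m.+1),
    topological_chart U phi ->
    (forall c, smooth_transition U phi (mdom c) (mcoord c) /\
               smooth_transition (mdom c) (mcoord c) U phi) ->
    exists2 c, mdom c = U & forall p, U p -> mcoord c p = phi p }.

Section Manifold.
Variables (R : realType) (m : nat) (M : bmanifold R m).
Local Notation n := m.+1.
Local Notation mchart := (mchart M).
Implicit Types (c : mchart) (p : M).

Definition bcharted : charted R :=
  @Charted R M 'rV[R]_n mchart (@mdom R m M) (@mcoord R m M).

Definition bd : set M := [set p | exists2 c, mdom c p & mcoord c p 0 ord0 = 0].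

(* The first coordinate is r; dr <> 0 holds because r is a coordinate. *)
Definition boundary_chart c : Prop :=
  forall p, mdom c p -> (bd p <-> mcoord c p 0 ord0 = 0).

Definition chart_inv c p (x : 'rV[R]_n) : M :=
  xget p [set q | mdom c q /\ mcoord c q = x].

(* Partial derivative in the chart c, as a one-sided limit: the point
   x + h e_a stays in the half-space for h > 0. For f smooth this is the
   partial derivative of any smooth extension, also at boundary points. *)
Definition pderiv c (a : 'I_n) (f : M -> R) p : R :=
  lim (h^-1 * (f (chart_inv c p (mcoord c p + h *: delta_mx 0 a)) - f p)
       @[h --> 0^'+]).

(* first and second derivatives (u^i_j, u^i_jk); for each i, the array u^i_jk
   is stored as a row through mxvec *)
Definition jet : Type := ('M[R]_n * 'M[R]_(n, n * n))%type.
Definition jet2 (u : jet) (i j k : 'I_n) : R := u.2 i (mxvec_index j k).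
Definition mk_jet (u : 'M[R]_n) (f : 'I_n -> 'I_n -> 'I_n -> R) : jet :=
  (u, \matrix_(i < n) mxvec (\matrix_(j < n, k < n) f i j k)).

(* 2-jet of a composition *)
Definition jet_mul (u a : jet) : jet :=
  mk_jet (u.1 *m a.1) (fun i j k =>
    \sum_l u.1 i l * jet2 a l j k +
    \sum_l \sum_l' jet2 u i l l' * a.1 l j * a.1 l' k).

Definition invertible_jet (u : jet) : Prop :=
  u.1 \in unitmx /\ forall i j k, jet2 u i j k = jet2 u i k j.

(* 2-jet at p of the change of coordinates from c to c' *)
Definition transition_jet c c' p : jet :=
  let x' i := fun q : M => mcoord c' q 0 i in
  mk_jet (\matrix_(i, j) pderiv c j (x' i) p)
         (fun i j k => pderiv c j (pderiv c k (x' i)) p).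

(* Ambient space of the bundle of 2-frames: a point together with 2-jets
   indexed by the charts. The genuine 2-frames are the elements of P2: 2-jets of
   local diffeomorphisms at 0, read in every chart at the point, the readings
   being related by the chain rule (and 0, by convention, in charts not
   containing the point). The chart c of M provides the canonical coordinates
   (x^i, u^i_j, u^i_jk). *)
Definition frames : charted R :=
  @Charted R (M * (mchart -> jet))%type
    ('rV[R]_n * ('M[R]_n * 'M[R]_(n, n * n)))%type mchart
    (fun c => [set q | mdom c q.1])
    (fun c q => (mcoord c q.1, q.2 c)).

Definition frame_base (q : frames) : bcharted := q.1.

Definition P2 : set frames := [set q |
  [/\ forall c, mdom c q.1 -> invertible_jet (q.2 c),
      forall c, ~ mdom c q.1 -> q.2 c = (0, 0) &
      forall c c', mdom c q.1 -> mdom c' q.1 ->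
        q.2 c' = jet_mul (transition_jet c c' q.1) (q.2 c)]].

(* Matrices are written as representatives modulo Z. *)
Definition PGL_group : set 'M[R]_(n + 1) := [set g | g \in unitmx].

Definition H_group : set 'M[R]_(n + 1) := [set h |
  exists (A : 'M[R]_n) (Y : 'rV[R]_n) (a : R),
    [/\ A \in unitmx, a != 0 & h = block_mx A 0 Y a%:M]].

(* blocks of size 1, m, 1 *)
Definition Gt_group : set 'M[R]_(n + 1) := [set g |
  exists (a : R) (b : 'cV[R]_m) (A : 'M[R]_m) (u : 'cV[R]_m)
         (beta : R) (delta : 'rV[R]_m) (gamma : R),
    [/\ a != 0, block_mx A u delta gamma%:M \in unitmx &
        g = block_mx (block_mx (a%:M : 'M[R]_1) 0 b A : 'M[R]_(1 + m))
                     (col_mx (0 : 'M[R]_1) u)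
                     (row_mx (beta%:M : 'M[R]_1) delta) gamma%:M]].

Definition Ht_group : set 'M[R]_(n + 1) := [set h |
  exists (a : R) (b : 'cV[R]_m) (A : 'M[R]_m)
         (beta : R) (delta : 'rV[R]_m) (gamma : R),
    [/\ a != 0, gamma != 0, A \in unitmx &
        h = block_mx (block_mx (a%:M : 'M[R]_1) 0 b A : 'M[R]_(1 + m))
                     0 (row_mx (beta%:M : 'M[R]_1) delta) gamma%:M]].

(* the embedding of H in G^2(R^n), after division by the last entry a *)
Definition H_jet (h : 'M[R]_(n + 1)) : jet :=
  let a := drsubmx h 0 0 in
  let A := a^-1 *: ulsubmx h in
  let Y := a^-1 *: dlsubmx h in
  mk_jet A (fun i j k => - (A i j * Y 0 k + A i k * Y 0 j)).

Definition frame_act (q : frames) (h : 'M[R]_(n + 1)) : frames :=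
  (q.1, fun c => jet_mul (q.2 c) (H_jet h)).

Definition H_orbit (q : frames) : set frames :=
  [set frame_act q h | h in H_group].

(* Points of P2 / H are orbits; a section of P2 / H is smooth when it has
   smooth local lifts to P2. *)
Definition projective_structure (s : M -> set frames) : Prop :=
  (forall p, exists q, [/\ P2 q, q.1 = p & s p = H_orbit q]) /\
  (forall p, exists (W : set bcharted) (f : bcharted -> frames),
     [/\ @chart_nbhd R bcharted p W,
         forall y, W y -> [/\ P2 (f y), (f y).1 = y & s y = H_orbit (f y)] &
         smooth_on W f]).

Variable s : M -> set frames.

Definition Pbundle : set frames := [set q | P2 q /\ H_orbit q = s q.1].

(* A torsion-free connection with Christoffel symbols Gamma in the chart c
   belongs to the class iff the 2-frames of coordinates (x, delta, - Gamma)
   represent s. One such Gamma is chosen; thomas does not depend on the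
   choice. *)
Definition christoffel c p : 'M[R]_(n, n * n) :=
  xget 0 [set Gam | exists2 q, s p q & q.2 c = (1%:M, - Gam)].

Definition thomas c p (i j k : 'I_n) : R :=
  let Gam i j k := jet2 (1%:M, christoffel c p) i j k in
  Gam i j k - (n.+1%:R)^-1 * (\sum_l Gam l l k) * (i == j)%:R
            - (n.+1%:R)^-1 * (\sum_l Gam l l j) * (i == k)%:R.

(* the section sigma_x of the chart c *)
Definition sigma c (p : bcharted) : frames :=
  xget (p, fun=> (0, 0))
    [set q | [/\ P2 q, q.1 = p &
                 q.2 c = mk_jet 1%:M (fun i j k => - thomas c p i j k)]].

(* the value of d Pi^i_j + Pi^i_k /\ Pi^k_j at p on the
   coordinate vectors of indices a, b *)
Definition thomas_curvature c p (i j a b : 'I_n) : R :=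
  pderiv c a (fun q => thomas c q i j b) p -
  pderiv c b (fun q => thomas c q i j a) p +
  \sum_k (thomas c p i k a * thomas c p k j b -
          thomas c p i k b * thomas c p k j a).

Definition schouten c p (l j : 'I_n) : R :=
  (n.-1%:R)^-1 * \sum_i thomas_curvature c p i j i l.

(* the displayed matrix-valued form, at p, on the vector of components v *)
Definition normal_gauge c p (v : 'rV[R]_n) : 'M[R]_(n + 1) :=
  block_mx (\matrix_(i, j) \sum_k thomas c p i j k * v 0 k) v^T
           (\row_j - \sum_k schouten c p k j * v 0 k) 0.

Definition normal_cartan_connection
    (om : frames -> chart frames -> model frames -> 'M[R]_(n + 1)) : Prop :=
  cartan_geometry frame_base frame_act setT Pbundle PGL_group H_group om /\
  (* the pull-back of om by sigma c, evaluated on velocities of curves *)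
  forall c p (gam : R -> bcharted) (v : 'rV[R]_n) (w : model frames),
    @velocity R bcharted setT gam p c v ->
    velocity Pbundle (fun t => sigma c (gam t)) (sigma c p) c w ->
    om (sigma c p) c w = mod_scalars (normal_gauge c p v).

(* Pi^0_mu lies in span(dr) at p for all mu >= 1 *)
Definition Pi0_in_span_dr c p : Prop :=
  forall mu : 'I_m, exists lambda : R, forall k : 'I_n,
    thomas c p ord0 (lift ord0 mu) k = lambda * (k == ord0)%:R.

Definition Qbundle : set frames := [set q |
  exists c p h, [/\ boundary_chart c, mdom c p, bd p, Ht_group h &
                    q = frame_act (sigma c p) h]].

End Manifold.

Arguments PGL_group R m : clear implicits.
Arguments H_group R m : clear implicits.
Arguments Gt_group R m : clear implicits.
Arguments Ht_group R m : clear implicits.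

(* Main.v *)
(* Every chart reading a boundary point reads the whole boundary as {x^0 = 0},
   so along the boundary the 2-jets u of the coordinate changes satisfy
   u^0_mu = 0 and u^0_{mu nu} = 0 for mu, nu >= 1; call such jets flat. Flat
   jets are closed under composition and the jets of elements of H~ are flat.
   Moreover Pi^0_mu lies in span(dr) for all mu iff the frame sigma_x(p) is
   flat, which therefore does not depend on the chart, and Q consists of the
   frames of P over the boundary with u^0_mu = 0.
   A curve in Q reads sigma_x(x(t)).h(t) with x^0(t) = 0 and h(t) in H~, so by
   the Leibniz rule omega takes on its velocity the value
   Ad(h^-1)(gauge matrix of x') + h^-1 h'. The off-diagonal entries of row 0 of
   the gauge matrix are Pi^0_{mu k} x'^k and x'^0, and vanish: omega maps TQ to
   the Lie algebra of G~. It is injective since it is so on P. Any X in the Lie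
   algebra of G~ is attained: with v the last column of Ad(h) X, the velocity of
   sigma_x(x + t v).h accounts for X up to an element of the Lie algebra of H~,
   which is the value on a vertical vector. *)
From HB Require Import structures.
Require Import Defs.
From mathcomp Require Import ring.
Set Implicit Arguments.
Unset Strict Implicit.
Unset Printing Implicit Defensive.
Import Order.TTheory GRing.Theory Num.Theory.
Local Open Scope classical_set_scope.
Local Open Scope ring_scope.

(** * Smooth maps between finite-dimensional spaces *)

Section Calculus.
Variable R : realType.
Implicit Types U V W : normedModType R.

(** The obstacle is that [om] is known only through its axioms, which speak of velocities of actual
    curves in P, while curves may be one-sided and sigma_x is defined by a choice. Three devices
    answer this. Each H-orbit of jets with invertible linear part contains exactly one jet with
    identity linear part and trace-free second derivatives, computed by [norm_jet]; it is the
    reading of sigma_x, so sigma_x and the H-coordinate of a frame depend rationally on any frame of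
    the orbit, hence smoothly. A velocity in Q is split into the velocity of a translated section
    and that of a vertical curve, both genuine curves in P, to which equivariance and the
    fundamental-field axiom apply separately. Derivatives at time 0 are determined by the times t >=
    0, and a boundary point may be moved along x + t v with v^0 = 0, which stays in the half-space.
    Since H~ leaves the row Upsilon free, Q is cut out of P over the boundary by first-order
    conditions, while the condition on Pi^0_mu is of second order. *)

Lemma near_eq_differentiable V W (f g : V -> W) x :
  (\forall y \near x, f y = g y) -> differentiable f x -> differentiable g x.
Proof.
move=> fg /diff_locallyP [dc df].
have gE : g \o shift x = cst (g x) + 'd f x +o_ (0 : V) id.
  apply/eqaddoP => _/posnumP[e].
  have := df; move=> /eqaddoP /(_ e%:num) /(_ [gt0 of e%:num]) H.
  have fgx : f x = g x by exact: nbhs_singleton fg.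
  have fg0 : \forall y \near (0 : V), f (y + x) = g (y + x).
    by move: fg; rewrite (near_shift (0 : V)) subr0.
  by apply: filterS2 fg0 H => y; rewrite !fctE /= => ->; rewrite fgx.
apply/diff_locallyP; rewrite (diff_unique dc gE); split; [exact: dc|exact: gE].
Qed.

(** Openness turns equality on O into equality near each of its points, which is what continuity and
    directional derivatives see. The closure lemmas below use it to replace a derivative by its
    formula. *)
Lemma Ck_eq k V W (O : set V) (f g : V -> W) : open O ->
  (forall x, O x -> f x = g x) -> Ck k O f -> Ck k O g.
Proof.
move=> oO; elim: k f g => [|k IH] f g fg.
  move=> Cf x Ox; suff: g @ x --> g x by [].
  rewrite -(fg _ Ox).
  apply: cvg_trans (Cf _ Ox); apply: near_eq_cvg.
  by have := open_nbhs_nbhs (conj oO Ox); apply: filterS.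
move=> /= [df Cf].
have nfg x : O x -> \forall y \near x, f y = g y.
  by move=> Ox; have := open_nbhs_nbhs (conj oO Ox); apply: filterS.
split=> [x Ox|v]; first by apply: near_eq_differentiable (df _ Ox); exact: nfg.
by apply: IH (Cf v) => x Ox; apply: near_eq_derive; exact: nfg.
Qed.

Lemma Ck_sub k V W (O O' : set V) (f : V -> W) : O' `<=` O ->
  Ck k O f -> Ck k O' f.
Proof.
move=> sO; elim: k f => [|k IH] f /=; first by move=> Cf x /sO /Cf.
by move=> [df Cf]; split=> [x /sO /df|v]//; exact/IH.
Qed.

Lemma CkW k V W (O : set V) (f : V -> W) : Ck k.+1 O f -> Ck k O f.
Proof.
elim: k f => [|k IH] f; last by move=> [df Cf]; split => // v; exact/IH.
by move=> [df _] x Ox; apply: differentiable_continuous; exact: df.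
Qed.

Lemma Ck_cst k V W (O : set V) (a : W) : open O -> Ck k O (fun=> a).
Proof.
move=> oO; elim: k a => [|k IH] a; first by move=> x _; exact: cvg_cst.
split=> [x _|v]; first exact: differentiable_cst.
by apply: Ck_eq (IH 0) => // x Ox; rewrite derive_cst.
Qed.

Lemma Ck_add k V W (O : set V) (f g : V -> W) : open O ->
  Ck k O f -> Ck k O g -> Ck k O (fun x => f x + g x).
Proof.
move=> oO; elim: k f g => [|k IH] f g.
  by move=> Cf Cg x Ox; apply: continuousD; [exact: Cf|exact: Cg].
move=> /= [df Cf] [dg Cg]; split=> [x Ox|v].
  by apply: differentiableD; [exact: df|exact: dg].
apply: Ck_eq (IH _ _ (Cf v) (Cg v)) => // x Ox.
by rewrite -deriveD //; apply: diff_derivable; [exact: df|exact: dg].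
Qed.

Lemma Ck_mul k V (O : set V) (f g : V -> R) : open O ->
  Ck k O f -> Ck k O g -> Ck k O (fun x => f x * g x).
Proof.
move=> oO; elim: k f g => [|k IH] f g.
  by move=> Cf Cg x Ox; apply: continuousM; [exact: Cf|exact: Cg].
move=> Cf Cg; have [df Df] := Cf; have [dg Dg] := Cg; split=> [x Ox|v].
  by apply: differentiableM; [exact: df|exact: dg].
apply: Ck_eq (Ck_add oO (IH _ _ (CkW Cf) (Dg v)) (IH _ _ (CkW Cg) (Df v))) => //.
move=> x Ox; rewrite -[LHS]/(f x *: _ + g x *: _) -deriveM //.
  by apply: diff_derivable; exact: df.
by apply: diff_derivable; exact: dg.
Qed.

Lemma Ck_inv k V (O : set V) (f : V -> R) : open O ->
  (forall x, O x -> f x != 0) -> Ck k O f -> Ck k O (fun x => (f x)^-1).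
Proof.
move=> oO f0; elim: k => [|k IH].
  by move=> Cf x Ox; apply: cvgV; [exact: f0|exact: Cf].
move=> Cf; have [df Df] := Cf; split=> [x Ox|v].
  by apply: differentiableV; [exact: df|exact: f0].
have C1 := IH (CkW Cf).
(* The derivative -(1/f)(1/f) f' involves 1/f itself, one order lower: the induction feeds on its
   own conclusion. *)
have C2 := Ck_mul oO (@Ck_cst k V R O (-1) oO) (Ck_mul oO (Ck_mul oO C1 C1) (Df v)).
apply: Ck_eq C2 => // x Ox.
rewrite deriveV; [|exact: f0|exact/diff_derivable/df].
by rewrite mulN1r scaleNr expr2 invfM.
Qed.

(* Equivalent to f being linear and continuous. *)
Definition clin V W (f : V -> W) : Prop :=
  forall x, differentiable f x /\ forall v, 'D_v f x = f v.

Lemma clinP V W (f : V -> W) : linear f -> continuous f -> clin f.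
Proof.
move=> lf cf x.
pose fM := GRing.isLinear.Build _ _ _ _ _ lf.
pose fL : {linear _ -> _} := HB.pack f fM.
have df : differentiable fL x by apply: linear_differentiable.
by split => // v; rewrite (deriveE v df) diff_lin.
Qed.

Lemma derive_clin V W W' (L : W -> W') (f : V -> W) x v : clin L ->
  differentiable f x -> 'D_v (L \o f) x = L ('D_v f x).
Proof.
move=> cL df; have [dL LE] := cL (f x).
rewrite deriveE; last exact: differentiable_comp.
by rewrite diff_comp //= -(deriveE _ dL) LE -deriveE.
Qed.

Lemma Ck_clin k V W W' (L : W -> W') (O : set V) (f : V -> W) : open O ->
  clin L -> Ck k O f -> Ck k O (L \o f).
Proof.
move=> oO cL; elim: k f => [|k IH] f.
  move=> Cf x Ox; apply: continuous_comp; first exact: Cf.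
  by apply: differentiable_continuous; have [] := cL (f x).
move=> /= [df Cf]; split=> [x Ox|v].
  by apply: differentiable_comp; [exact: df|have [] := cL (f x)].
by apply: Ck_eq (IH _ (Cf v)) => // x Ox; rewrite derive_clin //; exact: df.
Qed.

Lemma Ck_id k V (O : set V) : open O -> Ck k O (@id V).
Proof.
move=> oO; case: k => [|k]; first by move=> x _; exact: cvg_id.
split=> [x Ox|v]; first by apply: ex_diff.
by apply: Ck_eq (Ck_cst k v oO) => // x Ox; rewrite derive_id.
Qed.

Lemma Ck_sum k V W (O : set V) (I : Type) (r : seq I) (P : pred I)
    (f : I -> V -> W) : open O ->
  (forall i, P i -> Ck k O (f i)) -> Ck k O (fun x => \sum_(i <- r | P i) f i x).
Proof.
move=> oO Cf; elim: r => [|i r IH].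
  by apply: Ck_eq (Ck_cst k 0 oO) => // x _; rewrite big_nil.
case Pi : (P i); last by apply: Ck_eq IH => // x _; rewrite big_cons Pi.
by apply: Ck_eq (Ck_add oO (Cf _ Pi) IH) => // x _; rewrite big_cons Pi.
Qed.

(** Finite dimension in the form used by the chain rule: every vector expands along fixed vectors,
    with smooth linear coefficients. *)
Definition findim V : Prop :=
  exists (I : finType) (e : I -> V) (phi : I -> V -> R),
    (forall i, clin (phi i)) /\ forall v, v = \sum_i phi i v *: e i.

Lemma clin_scale V (e : V) : clin (fun t : R => t *: e).
Proof.
apply: clinP; last exact: scalel_continuous.
by move=> a x y; rewrite scalerDl scalerA.
Qed.

(** [Ck] differentiates along fixed directions, whereas the chain rule differentiates g along
    ['D_v f x], which moves with x. Expanding this direction in W, and the result in W', leaves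
    products of scalar functions, covered by [Ck_mul]. *)
Lemma Ck_comp k V W W' (O : set V) (O' : set W) (f : V -> W) (g : W -> W') :
  findim W -> findim W' -> open O -> open O' -> (forall x, O x -> O' (f x)) ->
  Ck k O f -> Ck k O' g -> Ck k O (g \o f).
Proof.
move=> [I [e [phi [cphi eE]]]] fW' oO oO' fO.
elim: k f g fO => [|k IH] f g fO.
  move=> Cf Cg x Ox; apply: continuous_comp; first exact: Cf.
  by apply: Cg; exact: fO.
move=> Cf Cg; have [df Df] := Cf; have [dg Dg] := Cg.
have dgf x : O x -> differentiable (g \o f) x.
  by move=> Ox; apply: differentiable_comp; [exact: df|apply/dg/fO].
split=> // v.
have [J [e' [psi [cpsi eE']]]] := fW'.
have H : Ck k O (fun x => \sum_j (\sum_i (phi i \o 'D_v f) x *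
                                 (psi j \o ('D_(e i) g \o f)) x) *: e' j).
  apply: Ck_sum => // j _.
  have Cs : Ck k O (fun x => \sum_i (phi i \o 'D_v f) x *
                                 (psi j \o ('D_(e i) g \o f)) x).
    apply: Ck_sum => // i _; apply: Ck_mul => //.
      exact: (Ck_clin oO (cphi i) (Df v)).
    by apply: (Ck_clin oO (cpsi j)); apply: IH (Dg _) => //; exact: CkW.
  exact: (Ck_clin oO (@clin_scale _ (e' j)) Cs).
apply: Ck_eq H => // x Ox.
have dfx := df _ Ox; have dgx := dg _ (fO _ Ox).
have lZ (a : R) u : 'd g (f x) (a *: u) = a *: 'D_u g (f x).
  by rewrite (deriveE _ dgx); exact: linearZ.
rewrite [RHS](deriveE v (dgf _ Ox)) diff_comp //= -(deriveE v dfx).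
rewrite [in RHS](eE ('D_v f x)) raddf_sum.
transitivity (\sum_i phi i ('D_v f x) *: 'D_(e i) g (f x)); last first.
  by apply: eq_bigr => i _; exact/esym/lZ.
under eq_bigr do rewrite scaler_suml.
rewrite exchange_big /=; apply: eq_bigr => i _.
by rewrite [in RHS](eE' ('D_(e i) g (f x))) scaler_sumr; apply: eq_bigr => j _;
  rewrite scalerA.
Qed.


(** Smoothness of the germ at x. It depends on f only near x, so domains need not be carried through
    the constructions. *)
Definition smoothat V W (x : V) (f : V -> W) : Prop :=
  exists O, [/\ open O, O x & smooth O f].

Lemma smooth_smoothat V W (O : set V) (f : V -> W) x :
  open O -> O x -> smooth O f -> smoothat x f.
Proof. by move=> oO Ox sf; exists O. Qed.

Lemma smoothat_near V W (x : V) (f : V -> W) :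
  smoothat x f -> \forall y \near x, smoothat y f.
Proof.
move=> [ O [oO Ox sf]]; have := open_nbhs_nbhs (conj oO Ox).
by apply: filterS => y Oy; exists O.
Qed.

Lemma smoothat_eq V W (x : V) (f g : V -> W) :
  (\forall y \near x, f y = g y) -> smoothat x f -> smoothat x g.
Proof.
move=> fg [ O [oO Ox sf]].
have oI := open_interior [set y | f y = g y].
exists (O `&` interior [set y | f y = g y]); split; first exact: openI.
  by split.
move=> k; apply: (@Ck_eq k _ _ _ f); first exact: openI.
  by move=> y [_ /interior_subset].
by apply: Ck_sub (sf k) => y [].
Qed.

Lemma smoothat_ext V W (x : V) (f g : V -> W) :
  f =1 g -> smoothat x f -> smoothat x g.
Proof. by move=> /funext ->. Qed.

Lemma smoothat_differentiable V W (x : V) (f : V -> W) :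
  smoothat x f -> differentiable f x.
Proof. by move=> [ O [_ Ox /(_ 1%N) [df _]]]; exact: df. Qed.

Lemma smoothat_continuous V W (x : V) (f : V -> W) :
  smoothat x f -> f @ x --> f x.
Proof. by move=> [ O [_ Ox /(_ 0%N)]]; exact. Qed.

Lemma near_neq0 V (f : V -> R) x : smoothat x f -> f x != 0 ->
  \forall y \near x, f y != 0.
Proof.
move=> /smoothat_continuous cf fx0.
have : nbhs (f x) [set y | y != 0].
  by apply: open_nbhs_nbhs; split => //; exact: open_neq0.
by move=> /cf.
Qed.

Lemma smoothat_derive V W (x v : V) (f : V -> W) :
  smoothat x f -> smoothat x ('D_v f).
Proof.
move=> [ O [oO Ox sf]]; exists O; split => // k.
by have [_] := sf k.+1; exact.
Qed.

Lemma smoothat_cst V W (x : V) (a : W) : smoothat x (fun=> a).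
Proof.
by exists setT; split => //; [exact: openT|move=> k; apply/Ck_cst/openT].
Qed.

Lemma smoothat_id V (x : V) : smoothat x id.
Proof.
by exists setT; split => //; [exact: openT|move=> k; apply/Ck_id/openT].
Qed.

Lemma smoothat_clin V W (L : V -> W) x : clin L -> smoothat x L.
Proof.
move=> cL; exists setT; split => //; first exact: openT.
by move=> k; apply: (Ck_clin openT cL); apply/Ck_id/openT.
Qed.

Lemma smoothat_clin_comp V W W' (L : W -> W') (f : V -> W) x : clin L ->
  smoothat x f -> smoothat x (fun y => L (f y)).
Proof.
move=> cL [ O [oO Ox sf]]; exists O; split => // k.
exact: Ck_clin (sf k).
Qed.

Lemma smoothat_op2 V W1 W2 W (op : W1 -> W2 -> W) (f : V -> W1) (g : V -> W2) x :
  (forall k (O : set V) (f : V -> W1) (g : V -> W2), open O ->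
    Ck k O f -> Ck k O g -> Ck k O (fun y => op (f y) (g y))) ->
  smoothat x f -> smoothat x g -> smoothat x (fun y => op (f y) (g y)).
Proof.
move=> H [ O [oO Ox sf]] [ O' [oO' Ox' sg]]; exists (O `&` O'); split => //.
  exact: openI.
move=> k; apply: H; first exact: openI.
  by apply: Ck_sub (sf k) => y [].
by apply: Ck_sub (sg k) => y [].
Qed.

Lemma smoothat_add V W (f g : V -> W) x :
  smoothat x f -> smoothat x g -> smoothat x (fun y => f y + g y).
Proof. by apply: smoothat_op2 => k O f' g'; exact: Ck_add. Qed.

Lemma smoothat_mul V (f g : V -> R) x :
  smoothat x f -> smoothat x g -> smoothat x (fun y => f y * g y).
Proof. by apply: smoothat_op2 => k O f' g'; exact: Ck_mul. Qed.

Lemma smoothat_opp V (f : V -> R) x :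
  smoothat x f -> smoothat x (fun y => - f y).
Proof.
move=> sf; apply: (@smoothat_ext _ _ _ (fun y => -1 * f y)).
  by move=> y; rewrite mulN1r.
by apply: smoothat_mul => //; exact: smoothat_cst.
Qed.

Lemma smoothat_inv V (f : V -> R) x : f x != 0 ->
  smoothat x f -> smoothat x (fun y => (f y)^-1).
Proof.
move=> fx0 sf; have [ O [oO Ox Of]] := sf.
have n0 : \forall y \near x, f y != 0.
  exact: near_neq0.
exists (O `&` interior [set y | f y != 0]).
have oI : open (O `&` interior [set y | f y != 0]).
  by apply: openI => //; exact: open_interior.
split => // k; apply: Ck_inv => //; first by move=> y [_ /interior_subset].
by apply: Ck_sub (Of k) => y [].
Qed.

Lemma smoothat_sum V W (I : Type) (r : seq I) (P : pred I) (f : I -> V -> W) x :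
  (forall i, P i -> smoothat x (f i)) ->
  smoothat x (fun y => \sum_(i <- r | P i) f i y).
Proof.
move=> sf; elim: r => [|i r IH].
  by apply: smoothat_ext (smoothat_cst x 0) => y; rewrite big_nil.
case Pi : (P i); last by apply: smoothat_ext IH => y; rewrite big_cons Pi.
by apply: smoothat_ext (smoothat_add (sf _ Pi) IH) => y; rewrite big_cons Pi.
Qed.

Lemma smoothat_prod V (I : Type) (r : seq I) (P : pred I) (f : I -> V -> R) x :
  (forall i, P i -> smoothat x (f i)) ->
  smoothat x (fun y => \prod_(i <- r | P i) f i y).
Proof.
move=> sf; elim: r => [|i r IH].
  by apply: smoothat_ext (@smoothat_cst V R x 1) => y; rewrite big_nil.
case Pi : (P i); last by apply: smoothat_ext IH => y; rewrite big_cons Pi.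
by apply: smoothat_ext (smoothat_mul (sf _ Pi) IH) => y; rewrite big_cons Pi.
Qed.

Lemma smoothat_comp V W W' (f : V -> W) (g : W -> W') x :
  findim W -> findim W' ->
  smoothat x f -> smoothat (f x) g -> smoothat x (fun y => g (f y)).
Proof.
move=> fW fW' sf [ O' [oO' Ox' sg]]; have [ O [oO Ox Of]] := sf.
have oI : open (O `&` interior (f @^-1` O')).
  by apply: openI => //; exact: open_interior.
exists (O `&` interior (f @^-1` O')); split => //.
  by split => //; have /(smoothat_continuous sf) := open_nbhs_nbhs (conj oO' Ox').
move=> k; apply: (Ck_comp fW fW' oI oO' _ _ (sg k)).
  by move=> y [_ /interior_subset].
by apply: Ck_sub (Of k) => y [].
Qed.

Lemma clin_id V : clin (@id V).
Proof. by apply: clinP => // x; exact: cvg_id. Qed.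

Lemma clin_comp V W W' (f : V -> W) (g : W -> W') :
  clin f -> clin g -> clin (fun x => g (f x)).
Proof.
move=> cf cg x; have [df fE] := cf x; split.
  by apply: differentiable_comp => //; have [] := cg (f x).
by move=> v; rewrite -[RHS]/(g (f v)) -fE -derive_clin.
Qed.

Lemma clin_fst V W : clin (@fst V W).
Proof. by apply: clinP => // x; exact: cvg_fst. Qed.

Lemma clin_snd V W : clin (@snd V W).
Proof. by apply: clinP => // x; exact: cvg_snd. Qed.

Lemma clin_inl V W : clin (fun x : V => (x, 0 : W)).
Proof.
apply: clinP => [a x y|x].
  by congr pair; rewrite /= scaler0 addr0.
by apply: cvg_pair; [exact: cvg_id|exact: cvg_cst].
Qed.

Lemma clin_inr V W : clin (fun x : W => (0 : V, x)).
Proof.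
apply: clinP => [a x y|x].
  by congr pair; rewrite /= scaler0 addr0.
by apply: cvg_pair; [exact: cvg_cst|exact: cvg_id].
Qed.

Lemma clin_coord p q (i : 'I_p) (j : 'I_q) :
  clin (fun A : 'M[R]_(p, q) => A i j).
Proof.
apply: clinP => [a x y|]; first by rewrite !mxE.
exact: coord_continuous.
Qed.

Lemma findim_scalar : findim R.
Proof.
exists 'I_1, (fun=> 1), (fun=> id); split => [i|v]; first exact: clin_id.
by rewrite big_ord1 [RHS]mulr1.
Qed.

Lemma findim_mx p q : findim 'M[R]_(p, q).
Proof.
exists ('I_p * 'I_q)%type, (fun ij => delta_mx ij.1 ij.2),
  (fun ij (A : 'M[R]_(p, q)) => A ij.1 ij.2); split => [ij|A]; first exact: clin_coord.
by rewrite {1}[A]matrix_sum_delta pair_big.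
Qed.

Lemma findim_prod V W : findim V -> findim W -> findim (V * W)%type.
Proof.
move=> [I [e [phi [cphi eE]]]] [J [e' [psi [cpsi eE']]]].
exists (I + J)%type,
  (fun ij => match ij with inl i => (e i, 0) | inr j => (0, e' j) end),
  (fun ij v => match ij with inl i => phi i v.1 | inr j => psi j v.2 end).
split=> [[i|j]|[v w]].
- exact: clin_comp (@clin_fst V W) (cphi i).
- exact: clin_comp (@clin_snd V W) (cpsi j).
rewrite big_sumType /=.
have -> : \sum_i phi i v *: (e i, 0 : W) = (v, 0).
  rewrite [in RHS](eE v).
  by elim/big_ind2 : _ => [|? ? ? ? -> ->|i _] //; congr pair; rewrite /= ?scaler0 ?addr0.
have -> : \sum_j psi j w *: (0 : V, e' j) = (0, w).
  rewrite [in RHS](eE' w).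
  by elim/big_ind2 : _ => [|? ? ? ? -> ->|i _] //; congr pair; rewrite /= ?scaler0 ?addr0.
by congr pair; rewrite /= ?addr0 ?add0r.
Qed.

Lemma smoothat_fst V W W' (f : V -> W * W') x :
  smoothat x f -> smoothat x (fun y => (f y).1).
Proof. exact: (smoothat_clin_comp (@clin_fst W W')). Qed.

Lemma smoothat_snd V W W' (f : V -> W * W') x :
  smoothat x f -> smoothat x (fun y => (f y).2).
Proof. exact: (smoothat_clin_comp (@clin_snd W W')). Qed.

Lemma smoothat_pair V W W' (f : V -> W) (g : V -> W') x :
  smoothat x f -> smoothat x g -> smoothat x (fun y => (f y, g y)).
Proof.
move=> sf sg.
apply: smoothat_ext (smoothat_add (smoothat_clin_comp (@clin_inl W W') sf)
  (smoothat_clin_comp (@clin_inr W W') sg)) => y.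
by congr pair; rewrite /= ?addr0 ?add0r.
Qed.

Lemma smoothat_coord V p q (f : V -> 'M[R]_(p, q)) x i j :
  smoothat x f -> smoothat x (fun y => f y i j).
Proof. exact: (smoothat_clin_comp (clin_coord i j)). Qed.

Lemma smoothat_mx V p q (f : V -> 'M[R]_(p, q)) x :
  (forall i j, smoothat x (fun y => f y i j)) -> smoothat x f.
Proof.
move=> sf; apply: (@smoothat_ext _ _ _
  (fun y => \sum_i \sum_j f y i j *: delta_mx i j)).
  by move=> y; rewrite -matrix_sum_delta.
apply: smoothat_sum => i _; apply: smoothat_sum => j _.
exact: (smoothat_clin_comp (clin_scale _) (sf i j)).
Qed.

Lemma smoothat_mulmx V p q r (f : V -> 'M[R]_(p, q)) (g : V -> 'M[R]_(q, r)) x :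
  smoothat x f -> smoothat x g -> smoothat x (fun y => f y *m g y).
Proof.
move=> sf sg; apply: smoothat_mx => i j.
apply: (@smoothat_ext _ _ _ (fun y => \sum_k f y i k * g y k j)).
  by move=> y; rewrite mxE.
by apply: smoothat_sum => k _; apply: smoothat_mul; exact: smoothat_coord.
Qed.

Lemma smoothat_det V p (f : V -> 'M[R]_p) x :
  smoothat x f -> smoothat x (fun y => \det (f y)).
Proof.
move=> sf; apply: smoothat_sum => s _; apply: smoothat_mul.
  exact: smoothat_cst.
by apply: smoothat_prod => i _; exact: smoothat_coord.
Qed.

Lemma smoothat_invmx V p (f : V -> 'M[R]_p) x : f x \in unitmx ->
  smoothat x f -> smoothat x (fun y => invmx (f y)).
Proof.
rewrite unitmxE unitfE => fx0 sf; have sdet := smoothat_det sf.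
have n0 : \forall y \near x, \det (f y) != 0.
  exact: near_neq0.
(* [invmx] returns a singular matrix unchanged, so Cramer's formula is available only near x. *)
apply: (@smoothat_eq _ _ _ (fun y => (\det (f y))^-1 *: \adj (f y))).
  apply: filterS n0 => y y0.
  by rewrite /invmx unitmxE unitfE y0.
apply: smoothat_mx => i j.
apply: (@smoothat_ext _ _ _
  (fun y => (\det (f y))^-1 * ((-1) ^+ (j + i) * \det (row' j (col' i (f y)))))).
  by move=> y; rewrite !mxE.
apply: smoothat_mul; first exact: smoothat_inv.
apply: smoothat_mul; first exact: smoothat_cst.
apply: smoothat_det; apply: smoothat_mx => k l.
apply: (@smoothat_ext _ _ _ (fun y => f y (lift j k) (lift i l))).
  by move=> y; rewrite !mxE.
exact: smoothat_coord.
Qed.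

Lemma near_unitmx V p (f : V -> 'M[R]_p) x : f x \in unitmx ->
  smoothat x f -> \forall y \near x, f y \in unitmx.
Proof.
rewrite unitmxE unitfE => fx0 sf.
apply: filterS (near_neq0 (smoothat_det sf) fx0) => y.
by rewrite unitmxE unitfE.
Qed.

End Calculus.

(** * Jets and the normalisation of frames *)

Section Jets.
Variables (R : realType) (m : nat).
Local Notation n := m.+1.
Local Notation jet := (jet R m).
Implicit Types u v a : jet.

Lemma jet2E (u : 'M[R]_n) f i j k : jet2 (mk_jet u f) i j k = f i j k.
Proof. by rewrite /jet2 /= mxE mxvecE mxE. Qed.

Lemma jet_ext u v : u.1 = v.1 ->
  (forall i j k, jet2 u i j k = jet2 v i j k) -> u = v.
Proof.
case: u v => [u1 u2] [v1 v2] /= <- uv; congr pair.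
apply/matrixP => i jk; case/mxvec_indexP: jk => j k; exact: uv.
Qed.

Lemma jet2_mul u a i j k : jet2 (jet_mul u a) i j k =
  \sum_l u.1 i l * jet2 a l j k +
  \sum_l \sum_l' jet2 u i l l' * a.1 l j * a.1 l' k.
Proof. exact: jet2E. Qed.

Lemma jet_mulA u v a : jet_mul u (jet_mul v a) = jet_mul (jet_mul u v) a.
Proof.
apply: jet_ext => [|i j k]; first by rewrite /= mulmxA.
rewrite !jet2_mul /=.
under eq_bigr do rewrite jet2_mul mulrDr.
rewrite big_split /= -addrA; congr (_ + _).
  under eq_bigr do rewrite mulr_sumr.
  rewrite exchange_big /=; apply: eq_bigr => l _.
  by rewrite mxE mulr_suml; apply: eq_bigr => l' _; rewrite mulrA.
under [X in _ = X]eq_bigr do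
  under eq_bigr do rewrite jet2_mul !mulrDl.
under [X in _ = X]eq_bigr do rewrite big_split /=.
rewrite big_split /=; congr (_ + _).
  under eq_bigr do rewrite mulr_sumr.
  rewrite exchange_big /=; apply: eq_bigr => l _.
  under eq_bigr do rewrite mulr_sumr.
  rewrite exchange_big /=; apply: eq_bigr => l' _.
  by rewrite !mulr_suml; apply: eq_bigr => x _; ring.
transitivity (\sum_l \sum_l' \sum_x \sum_y
    jet2 u i l l' * v.1 l x * v.1 l' y * a.1 x j * a.1 y k).
  apply: eq_bigr => l _; apply: eq_bigr => l' _.
  rewrite !mxE -mulrA mulr_suml mulr_sumr; apply: eq_bigr => x _.
  by rewrite !mulr_sumr; apply: eq_bigr => y _; ring.
transitivity (\sum_x \sum_y \sum_l \sum_l'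
    jet2 u i l l' * v.1 l x * v.1 l' y * a.1 x j * a.1 y k).
  under eq_bigr do rewrite exchange_big /=.
  rewrite exchange_big /=; apply: eq_bigr => x _.
  under eq_bigr do rewrite exchange_big /=.
  by rewrite exchange_big.
apply: eq_bigr => x _; apply: eq_bigr => y _.
rewrite !mulr_suml; apply: eq_bigr => l _.
by rewrite !mulr_suml.
Qed.

(** Once the linear parts agree, the terms in the second derivatives of u coincide on both sides,
    leaving [u.1] times the second-order parts. *)
Lemma jet_mulI u : u.1 \in unitmx -> injective (jet_mul u).
Proof.
move=> uu a b E.
have E1 : a.1 = b.1.
  have /= := congr1 fst E; exact: (can_inj (mulKmx uu)).
have E2 : u.1 *m a.2 = u.1 *m b.2.
  apply/matrixP => i jk; case/mxvec_indexP: jk => j k.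
  have := congr1 (fun v => jet2 v i j k) E; rewrite /= !jet2_mul E1.
  by move/addIr; rewrite !mxE.
by rewrite [a]surjective_pairing [b]surjective_pairing E1 (can_inj (mulKmx uu) E2).
Qed.

Definition jet_one : jet := mk_jet 1%:M (fun _ _ _ => 0).

Lemma jet_mul1 u : jet_mul u jet_one = u.
Proof.
apply: jet_ext => [|i j k]; first by rewrite /= mulmx1.
rewrite jet2_mul big1 => [|l _]; last by rewrite jet2E mulr0.
rewrite add0r (bigD1 j) //= (bigD1 k) //= !mxE !eqxx !mulr1.
rewrite !big1 ?addr0 // => [l /negPf lj|l /negPf lk].
  by rewrite big1 // => l' _; rewrite !mxE lj mulr0 mul0r.
by rewrite !mxE lk mulr0.
Qed.

Definition H_mx (A : 'M[R]_n) (Y : 'rV[R]_n) : 'M[R]_(n + 1) :=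
  block_mx A 0 Y 1%:M.

Lemma H_jet_block (A : 'M[R]_n) (Y : 'rV[R]_n) (a : R) :
  H_jet (block_mx A 0 Y a%:M) =
  mk_jet (a^-1 *: A) (fun i j k =>
    - (a^-1 * a^-1) * (A i j * Y 0 k + A i k * Y 0 j)).
Proof.
rewrite /H_jet block_mxKul block_mxKdl block_mxKdr !mxE eqxx mulr1n.
apply: jet_ext => // i j k; rewrite !jet2E !mxE; ring.
Qed.

(** [H_jet h] is the 2-jet at 0 of the projective map x -> A x / (Y x + a), and composing such maps
    multiplies their matrices. *)
Lemma H_jetM h k : H_group R m h -> H_group R m k ->
  H_jet (h *m k) = jet_mul (H_jet h) (H_jet k).
Proof.
move=> [A [Y [a [Au a0 ->]]]] [B [Z [b [Bu b0 ->]]]].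
rewrite mulmx_block !mulmx0 !mul0mx !addr0 add0r -scalar_mxM.
rewrite !H_jet_block; apply: jet_ext => /=.
  by rewrite -scalemxAl -scalemxAr scalerA invfM.
move=> i j k0; rewrite jet2E jet2_mul /=.
under eq_bigr do rewrite jet2E !mxE.
under [X in _ = _ + X]eq_bigr do under eq_bigr do rewrite jet2E !mxE.
have -> : \sum_i0 a^-1 * A i i0 *
    (- (b^-1 * b^-1) * (B i0 j * Z 0 k0 + B i0 k0 * Z 0 j)) =
    - (a^-1 * (b^-1 * b^-1)) * ((A *m B) i j * Z 0 k0 + (A *m B) i k0 * Z 0 j).
  rewrite !mxE !mulr_suml -big_split mulr_sumr; apply: eq_bigr => l _ /=; ring.
have -> : \sum_i0 \sum_i1 - (a^-1 * a^-1) *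
     (A i i0 * Y 0 i1 + A i i1 * Y 0 i0) * (b^-1 * B i0 j) * (b^-1 * B i1 k0) =
    - (a^-1 * a^-1 * (b^-1 * b^-1)) *
      ((A *m B) i j * (Y *m B) 0 k0 + (A *m B) i k0 * (Y *m B) 0 j).
  rewrite !mxE [X in X + _]mulr_suml [X in _ + X]mulr_sumr -big_split mulr_sumr.
  apply: eq_bigr => x _ /=; rewrite mulr_sumr mulr_suml -big_split mulr_sumr.
  apply: eq_bigr => y _ /=; ring.
have -> : (a%:M *m Z) = a *: Z by rewrite mul_scalar_mx.
rewrite !mxE; set AB := \sum_j0 _; set YB := \sum_j0 _; set AB' := \sum_j0 _.
set YB' := \sum_j0 _; by field; rewrite a0 b0.
Qed.

Lemma H_jet_scalar (a : R) : a != 0 -> H_jet (a%:M : 'M[R]_(n + 1)) = jet_one.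
Proof.
move=> a0; rewrite scalar_mx_block H_jet_block; apply: jet_ext => /=.
  by rewrite scale_scalar_mx mulVf.
by move=> i j k; rewrite !jet2E !mxE !mulr0 addr0 mulr0.
Qed.

(** The linear parts give B = (b / a) A; the second-order parts then give Z = (b / a) Y, because no
    column of an invertible A vanishes. *)
Lemma H_jet_inj h k : H_group R m h -> H_group R m k -> H_jet h = H_jet k ->
  exists a : R, k = a *: h.
Proof.
move=> [A [Y [a [Au a0 ->]]]] [B [Z [b [Bu b0 ->]]]].
rewrite !H_jet_block => E.
have /= EA := congr1 fst E.
have AE i j : B i j = b / a * A i j.
  have := congr1 (fun X : 'M[R]_n => X i j) EA; rewrite !mxE => e.
  by rewrite -mulrA e mulrA mulfV // mul1r.
have YE l : Z 0 l = b / a * Y 0 l.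
  have [i Aik] : exists i, A i l != 0.
    apply: contrapT => /forallNP A0.
    have : row_free A^T by rewrite row_free_unit unitmx_tr.
    move/row_freeP => [X AX].
    have := congr1 (fun X : 'M[R]_n => X l l) AX.
    rewrite !mxE eqxx big1 => [/esym/eqP|i _].
      by rewrite oner_eq0.
    by rewrite mxE; have := A0 i => /negP; rewrite negbK => /eqP ->; rewrite mul0r.
  (* Equal lower indices turn the symmetrised product into 2 A_il Y_l, from which Y_l can be
     extracted. *)
  have := congr1 (fun u => jet2 u i l l) E; rewrite !jet2E !AE => e.
  have : (b * A i l) * (b * Y 0 l) * (-2) = (b * A i l) * (a * Z 0 l) * (-2).
    transitivity (a ^+2 * b ^+ 2 * (- (a^-1 * a^-1) * (A i l * Y 0 l + A i l * Y 0 l))).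
      by field; rewrite a0.
    by rewrite e; field; rewrite a0 b0.
  have bA0 : b * A i l != 0 by rewrite mulf_neq0.
  have n2 : (-2 : R) != 0 by rewrite oppr_eq0 pnatr_eq0.
  move=> /(mulIf n2)/(mulfI bA0) bY; apply: (mulfI a0); rewrite -bY.
  by field; rewrite a0.
exists (b / a); rewrite scale_block_mx scaler0 scale_scalar_mx divfK //.
by congr block_mx; apply/matrixP => i j; rewrite !mxE ?(ord1 i) ?AE ?YE.
Qed.

(* Composing u with the element of H below makes its linear part the identity
   and its quadratic part trace-free, as required of the section sigma. *)
Definition norm_shift u : 'rV[R]_n := \row_k (n.+1%:R^-1 *
  \sum_i \sum_a \sum_b jet2 u i a b * invmx u.1 a i * invmx u.1 b k).
Definition norm_mx u : 'M[R]_(n + 1) := H_mx (invmx u.1) (norm_shift u).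
Definition norm_jet u : jet := jet_mul u (H_jet (norm_mx u)).
Definition normal u : Prop :=
  u.1 = 1%:M /\ forall k, \sum_i jet2 u i i k = 0.

Lemma H_jet_mx (A : 'M[R]_n) (Y : 'rV[R]_n) : H_jet (H_mx A Y) =
  mk_jet A (fun i j k => - (A i j * Y 0 k + A i k * Y 0 j)).
Proof.
rewrite /H_mx H_jet_block; apply: jet_ext => /=; first by rewrite invr1 scale1r.
by move=> i j k; rewrite !jet2E invr1 mulr1 mulN1r.
Qed.

Lemma H_mx_group (A : 'M[R]_n) (Y : 'rV[R]_n) :
  A \in unitmx -> H_group R m (H_mx A Y).
Proof. by move=> uA; exists A, Y, 1; rewrite oner_neq0. Qed.

Lemma norm_mx_group u : u.1 \in unitmx -> H_group R m (norm_mx u).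
Proof. by move=> uu; apply: H_mx_group; rewrite unitmx_inv. Qed.

Lemma jet2_norm u i j k : u.1 \in unitmx -> jet2 (norm_jet u) i j k =
  (\sum_a \sum_b jet2 u i a b * invmx u.1 a j * invmx u.1 b k) -
  ((i == j)%:R * norm_shift u 0 k + (i == k)%:R * norm_shift u 0 j).
Proof.
move=> uu; rewrite jet2_mul H_jet_mx /= addrC; congr (_ + _).
under eq_bigr do rewrite jet2E mulrN mulrDr !mulrA.
rewrite sumrN; congr (- _); rewrite big_split /= -!mulr_suml.
have E x : \sum_(i0 < n) u.1 i i0 * invmx u.1 i0 x = (i == x)%:R.
  by have := mulmxV uu => /matrixP /(_ i x); rewrite !mxE.
by rewrite !E.
Qed.

(** Contracting i with j in delta_ij Y_k + delta_ik Y_j gives (n + 1) Y_k: this is the origin of the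
    factor [n.+1%:R^-1] in [norm_shift]. *)
Lemma norm_jet_normal u : u.1 \in unitmx -> normal (norm_jet u).
Proof.
move=> uu; split; first by rewrite /norm_jet /norm_mx H_jet_mx /= mulmxV.
move=> k; under eq_bigr do rewrite jet2_norm // eqxx mul1r.
rewrite sumrB big_split /= sumr_const card_ord.
have -> : \sum_(i < n) (i == k)%:R * norm_shift u 0 i = norm_shift u 0 k.
  rewrite (bigD1 k) //= eqxx mul1r big1 ?addr0 //.
  by move=> i /negPf ->; rewrite mul0r.
rewrite -mulrSr -mulr_natl mxE mulrA mulfV ?mul1r ?subrr //.
Qed.

(** Keeping the identity as linear part forces A = a; the trace then changes by -(n + 1) Y / a, so Y
    = 0 and h acts as a scalar. *)
Lemma normal_unique u h : normal u -> H_group R m h ->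
  normal (jet_mul u (H_jet h)) -> jet_mul u (H_jet h) = u.
Proof.
move=> [u1 ut] [A [Y [a [Au a0 ->]]]]; rewrite H_jet_block => -[].
rewrite /= u1 mul1mx => A1 tr.
have Y0 k : a^-1 * Y 0 k = 0.
  have := tr k.
  under eq_bigr => i _ do rewrite jet2_mul /= u1 A1.
  rewrite big_split /=.
  have -> : \sum_i \sum_l \sum_l' jet2 u i l l' * (1%:M : 'M[R]_n) l i *
                (1%:M : 'M[R]_n) l' k = 0.
    rewrite -[RHS](ut k); apply: eq_bigr => i _.
    rewrite (bigD1 i) //= [X in _ + X]big1 ?addr0; last first.
      by move=> l /negPf li; rewrite big1 // => l' _; rewrite !mxE li mulr0 mul0r.
    rewrite (bigD1 k) //= big1 ?addr0 ?mxE ?eqxx ?mulr1 //.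
    by move=> l /negPf li; rewrite !mxE li mulr0.
  rewrite addr0.
  have -> : \sum_i \sum_l (1%:M : 'M[R]_n) i l * jet2 (mk_jet (a^-1 *: A) (fun i j k =>
      - (a^-1 * a^-1) * (A i j * Y 0 k + A i k * Y 0 j))) l i k =
      - (n.+1%:R * (a^-1 * Y 0 k)).
    transitivity (\sum_i - (a^-1 * Y 0 k + (i == k)%:R * (a^-1 * Y 0 i))).
      apply: eq_bigr => i _; rewrite (bigD1 i) //= big1 ?addr0; last first.
        by move=> l /negPf li; rewrite mxE eq_sym li mul0r.
      rewrite jet2E mxE eqxx mul1r.
      have E x : a^-1 * A i x = (i == x)%:R.
        by have := congr1 (fun X : 'M[R]_n => X i x) A1; rewrite !mxE.
      transitivity (- ((a^-1 * A i i) * (a^-1 * Y 0 k) +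
                       (a^-1 * A i k) * (a^-1 * Y 0 i))); first ring.
      by rewrite !E eqxx mul1r.
    rewrite sumrN big_split /= sumr_const card_ord (bigD1 k) //= eqxx mul1r.
    rewrite [X in _ + (_ + X)]big1 ?addr0; last by move=> i /negPf ->; rewrite mul0r.
    by rewrite -mulrSr mulr_natl.
  move=> /eqP; rewrite oppr_eq0 mulf_eq0 pnatr_eq0 /= => /eqP //.
rewrite -[RHS]jet_mul1; congr jet_mul; apply: jet_ext => //= i j k.
rewrite !jet2E -[X in X * _]mulN1r.
transitivity (- ((a^-1 * A i j) * (a^-1 * Y 0 k) + (a^-1 * A i k) * (a^-1 * Y 0 j))).
  ring.
by rewrite !Y0 !mulr0 addr0 oppr0.
Qed.

Lemma H_jet_unit h : H_group R m h -> (H_jet h).1 \in unitmx.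
Proof.
move=> [A [Y [a [Au a0 ->]]]]; rewrite H_jet_block /=.
by rewrite unitmxZ // unitfE invr_eq0.
Qed.

End Jets.

(** * The groups G~, H~ and H *)

Section Stabilisers.
Variables (R : realType) (p : nat).
Implicit Types (i : 'I_p) (X Y : 'M[R]_p).

(** X preserves the hyperplane X_i = 0: the i-th coordinate form is a left eigenvector, a condition
    visibly kept by products and inverses. *)
Definition row_stable i X : Prop := forall j, j != i -> X i j = 0.
(** Dually, X fixes the i-th basis point of projective space. *)
Definition col_stable i X : Prop := row_stable i X^T.

Lemma row_stableP i X :
  row_stable i X <-> delta_mx 0 i *m X = X i i *: (delta_mx 0 i : 'rV_p).
Proof.
rewrite -rowE; split => [rX|/rowP rX j /negPf ji].
  apply/rowP => j; rewrite !mxE eqxx /=.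
  by have [->|ji] := eqVneq j i; rewrite ?mulr1 // mulr0 rX.
by have := rX j; rewrite !mxE eqxx ji mulr0.
Qed.

Lemma row_stable_ex i X (a : R) :
  delta_mx 0 i *m X = a *: (delta_mx 0 i : 'rV_p) -> row_stable i X.
Proof.
rewrite -rowE => /rowP rX j /negPf ji.
by have := rX j; rewrite !mxE eqxx ji mulr0.
Qed.

Lemma row_stableM i X Y :
  row_stable i X -> row_stable i Y -> row_stable i (X *m Y).
Proof.
move=> /row_stableP rX /row_stableP rY.
by apply: (@row_stable_ex _ _ (X i i * Y i i)); rewrite mulmxA rX -scalemxAl rY scalerA.
Qed.

Lemma row_stableV i X : X \in unitmx ->
  row_stable i X -> row_stable i (invmx X).
Proof.
move=> uX /row_stableP rX.
(* The eigenvalue is nonzero, otherwise X would have a zero row. *)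
have Xi0 : X i i != 0.
  apply/eqP => X0; move: rX; rewrite X0 scale0r => /(congr1 (mulmx^~ (invmx X))).
  rewrite mulmxK // mul0mx => /rowP /(_ i); rewrite !mxE !eqxx => /eqP.
  by rewrite oner_eq0.
apply: (@row_stable_ex _ _ (X i i)^-1).
apply: (canRL (scalerK Xi0)); rewrite scalemxAl -rX -mulmxA mulmxV //.
by rewrite mulmx1.
Qed.

Lemma row_stableD i X Y :
  row_stable i X -> row_stable i Y -> row_stable i (X + Y).
Proof. by move=> rX rY j ji; rewrite mxE rX // rY // addr0. Qed.

Lemma row_stableZ i a X : row_stable i X -> row_stable i (a *: X).
Proof. by move=> rX j ji; rewrite mxE rX // mulr0. Qed.

Lemma row_stable_scalar i a : row_stable i a%:M.
Proof. by move=> j /negPf ji; rewrite mxE eq_sym ji. Qed.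

Lemma col_stableM i X Y :
  col_stable i X -> col_stable i Y -> col_stable i (X *m Y).
Proof. by rewrite /col_stable trmx_mul => cX cY; exact: row_stableM. Qed.

Lemma col_stableV i X : X \in unitmx ->
  col_stable i X -> col_stable i (invmx X).
Proof.
by move=> uX cX; rewrite /col_stable trmx_inv; apply: row_stableV; rewrite ?unitmx_tr.
Qed.

Lemma col_stableD i X Y :
  col_stable i X -> col_stable i Y -> col_stable i (X + Y).
Proof. by rewrite /col_stable linearD; exact: row_stableD. Qed.

Lemma col_stableZ i a X : col_stable i X -> col_stable i (a *: X).
Proof. by rewrite /col_stable linearZ; exact: row_stableZ. Qed.

Lemma col_stable_scalar i a : col_stable i a%:M.
Proof. by rewrite /col_stable tr_scalar_mx; exact: row_stable_scalar. Qed.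

Lemma closure_entry0 (G : set 'M[R]_p) i j g :
  (forall h, G h -> h i j = 0) -> closure G g -> g i j = 0.
Proof.
move=> G0 cg; apply: contrapT => /eqP gij.
have : nbhs g [set h : 'M[R]_p | h i j != 0].
  have : nbhs (g i j) [set y : R | y != 0].
    by apply: open_nbhs_nbhs; split => //; exact: open_neq0.
  by move=> /(@coord_continuous R p p i j g).
by move=> /cg [h [/G0 h0 /=]]; rewrite h0 eqxx.
Qed.

End Stabilisers.

Section Groups.
Variables (R : realType) (m : nat).
Local Notation n := m.+1.
Local Notation MN := 'M[R]_(n + 1).

Definition i0 : 'I_(n + 1) := lshift 1 ord0.
Definition iN : 'I_(n + 1) := rshift n ord0.

Lemma i0N : (i0 == iN) = false.
Proof. by apply/eqP => /(congr1 val). Qed.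

(** Seeing H as the stabiliser of the last basis point yields its group properties without computing
    with blocks. *)
Lemma H_groupP (h : MN) : H_group R m h <-> h \in unitmx /\ col_stable iN h.
Proof.
split=> [[A [Y [a [uA a0 ->]]]]|[uh ch]].
  split; first by rewrite unitmxE det_lblock unitrM -unitmxE uA det_scalar1 unitfE.
  move=> j; rewrite mxE; case: (split_ordP j) => k -> kN.
    by rewrite block_mxEur mxE.
  by move: kN; rewrite (ord1 k) eqxx.
have hE : h = block_mx (ulsubmx h) 0 (dlsubmx h) (drsubmx h 0 0)%:M.
  rewrite -[LHS]submxK; congr block_mx.
    apply/matrixP => i j; rewrite !mxE (ord1 j).
    have := ch (lshift 1 i); rewrite mxE; apply.
    by rewrite eq_lrshift.
  by rewrite -mx11_scalar.
exists (ulsubmx h), (dlsubmx h), (drsubmx h 0 0); split => //.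
  by move: uh; rewrite {1}hE unitmxE det_lblock unitrM -unitmxE => /andP[].
by move: uh; rewrite {1}hE unitmxE det_lblock unitrM det_scalar1 !unitfE => /andP[].
Qed.

Lemma det_row_stable (g : MN) : row_stable i0 g ->
  \det g = g i0 i0 * \det (row' i0 (col' i0 g)).
Proof.
move=> rg; rewrite (expand_det_row _ i0) (bigD1 i0) //= big1 ?addr0.
  by rewrite /cofactor /= expr0 mul1r.
by move=> j ji; rewrite rg // mul0r.
Qed.

Definition Gt_block (a : R) (b : 'cV[R]_m) (A : 'M[R]_m) (u : 'cV[R]_m)
    (beta : R) (delta : 'rV[R]_m) (gamma : R) : MN :=
  block_mx (block_mx (a%:M : 'M[R]_1) 0 b A : 'M[R]_(1 + m))
    (col_mx (0 : 'M[R]_1) u) (row_mx (beta%:M : 'M[R]_1) delta) gamma%:M.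

Lemma Gt_block_row a b A u beta delta gamma :
  row_stable i0 (Gt_block a b A u beta delta gamma).
Proof.
(* The index is reread through the splitting 1 + m of the upper-left block. *)
have ->: i0 = lshift 1 (lshift m (ord0 : 'I_1)) by apply/val_inj.
move=> j; case: (split_ordP j) => k ->; last first.
  by rewrite /Gt_block block_mxEur (@col_mxEu R 1 m 1) mxE.
rewrite /Gt_block block_mxEul; case: (@split_ordP 1 m k) => l -> l0.
  by move: l0; rewrite (ord1 l) eqxx.
by rewrite (@block_mxEur R 1 m 1 m) mxE.
Qed.

Lemma Gt_block_minor a b A u beta delta gamma :
  row' i0 (col' i0 (Gt_block a b A u beta delta gamma)) =
  block_mx A u delta gamma%:M :> 'M[R]_(m + 1).
Proof.
apply/matrixP => i j; rewrite [LHS]mxE [LHS]mxE.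
have El k : lift i0 (lshift 1 k : 'I_(m + 1)) = lshift 1 (rshift 1 k) :> 'I_(n + 1).
  exact/val_inj.
have Er k : lift i0 (rshift m k : 'I_(m + 1)) = rshift n k :> 'I_(n + 1).
  exact/val_inj.
case: (split_ordP i) => k ->; case: (split_ordP j) => l ->; rewrite ?El ?Er.
- by rewrite /Gt_block !block_mxEul (@block_mxEdr R 1 m 1 m).
- by rewrite /Gt_block !block_mxEur (@col_mxEd R 1 m 1).
- by rewrite /Gt_block !block_mxEdl (@row_mxEr R 1 1 m).
- by rewrite /Gt_block !block_mxEdr.
Qed.


Lemma Gt_block_unit a b A u beta delta gamma :
  (Gt_block a b A u beta delta gamma \in unitmx) =
  (a != 0) && (block_mx A u delta gamma%:M \in unitmx).
Proof.
rewrite unitmxE det_row_stable; last exact: Gt_block_row.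
rewrite Gt_block_minor unitrM -unitmxE unitfE; congr ((_ != 0) && _).
have -> : i0 = lshift 1 (lshift m (0 : 'I_1)) by apply/val_inj.
by rewrite /Gt_block block_mxEul (@block_mxEul R 1 m 1 m) mxE eqxx.
Qed.

Lemma Gt_block_recover (g : MN) : row_stable i0 g ->
  exists a b A u beta delta gamma, g = Gt_block a b A u beta delta gamma.
Proof.
move=> rg; pose g' : 'M[R]_(1 + m) := ulsubmx g.
exists (g i0 i0), (dlsubmx g'), (drsubmx g'), (@dsubmx _ 1 m 1 (ursubmx g)),
  (@lsubmx _ 1 1 m (dlsubmx g) 0 0), (@rsubmx _ 1 1 m (dlsubmx g)),
  (drsubmx g 0 0).
rewrite -[LHS]submxK; apply: (f_equal4 (@block_mx R n 1 n 1)).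
- rewrite -[LHS](@submxK _ 1 m 1 m); apply: (f_equal4 (@block_mx R 1 m 1 m)) => //.
    apply/matrixP => i j; rewrite (ord1 i) (ord1 j) !mxE eqxx mulr1n.
    by congr (g _ _); apply/val_inj.
  apply/matrixP => i j; rewrite (ord1 i) !mxE.
  have -> : lshift 1 (lshift m (0 : 'I_1)) = i0 by apply/val_inj.
  by rewrite rg //; apply/eqP => /(congr1 val).
- rewrite -[LHS](@vsubmxK _ 1 m 1); apply: (f_equal2 (@col_mx R 1 m 1)) => //.
  apply/matrixP => i j; rewrite (ord1 i) !mxE.
  have -> : lshift 1 (lshift m (0 : 'I_1)) = i0 by apply/val_inj.
  by rewrite rg //; apply/eqP => /(congr1 val).
- by rewrite -[LHS](@hsubmxK _ 1 1 m) -mx11_scalar.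
- exact: mx11_scalar.
Qed.

(** Expanding along row [i0], the determinant is a times that of the minor with blocks A, u, delta,
    gamma, so the two nondegeneracy conditions of the definition together say that g is
    invertible. *)
Lemma Gt_groupP (g : MN) : Gt_group R m g <-> g \in unitmx /\ row_stable i0 g.
Proof.
split=> [[a [b [A [u [beta [delta [gamma [a0 uB ->]]]]]]]]|[ug rg]].
  rewrite -[block_mx _ _ _ _]/(Gt_block a b A u beta delta gamma).
  by rewrite Gt_block_unit a0 uB; split => //; exact: Gt_block_row.
have [a [b [A [u [beta [delta [gamma gE]]]]]]] := Gt_block_recover rg.
exists a, b, A, u, beta, delta, gamma.
by move: ug; rewrite {1}gE Gt_block_unit => /andP[].
Qed.

(** Inside G~, fixing the last basis point means u = 0, and the determinant of the minor then
    factors through A and gamma. *)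
Lemma Ht_groupP (h : MN) : Ht_group R m h <->
  [/\ h \in unitmx, row_stable i0 h & col_stable iN h].
Proof.
split=> [[a [b [A [beta [delta [gamma [a0 g0 uA ->]]]]]]]|[uh rh ch]].
  have HH : H_group R m (block_mx (block_mx (a%:M : 'M[R]_1) 0 b A : 'M[R]_(1 + m))
                     0 (row_mx (beta%:M : 'M[R]_1) delta) gamma%:M).
    exists (block_mx (a%:M : 'M[R]_1) 0 b A : 'M[R]_(1 + m)),
      (row_mx (beta%:M : 'M[R]_1) delta), gamma; split => //.
    by rewrite unitmxE (@det_lblock _ 1 m) det_scalar1 unitrM unitfE a0.
  have [uh ch] := (H_groupP _).1 HH; split => //.
  have := @Gt_block_row a b A 0 beta delta gamma.
  by rewrite /Gt_block (@col_mx0 R 1 m 1).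
have [a [b [A [u [beta [delta [gamma gE]]]]]]] := Gt_block_recover rh.
have u0 : u = 0.
  apply/matrixP => i j; rewrite (ord1 j) [RHS]mxE.
  have := ch (lshift 1 (rshift 1 i)); rewrite gE mxE /Gt_block block_mxEur.
  by rewrite (@col_mxEd R 1 m 1); apply; rewrite eq_lrshift.
move: uh; rewrite gE Gt_block_unit u0 => /andP[a0].
rewrite unitmxE det_lblock det_scalar1 unitrM => /andP[uA]; rewrite unitfE => g0.
by exists a, b, A, beta, delta, gamma; rewrite /Gt_block (@col_mx0 R 1 m 1).
Qed.

(** P is a condition on all matrices, closed in the whole matrix space; intersecting with the
    invertible ones gives a closed subgroup. *)
Definition mx_subgroup_closed (P : set MN) : Prop :=
  [/\ forall a : R, P a%:M, forall g h, P g -> P h -> P (g *m h),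
    forall g, g \in unitmx -> P g -> P (invmx g) &
    forall g, closure P g -> P g].

Lemma closed_matrix_subgroup (P G : set MN) : mx_subgroup_closed P ->
  (forall g, G g <-> g \in unitmx /\ P g) -> matrix_subgroup G.
Proof.
move=> [Ps Pm Pv Pc] GP; split.
- by move=> g /GP [].
- move=> a a0; apply/GP; split => //.
  by rewrite unitmxE det_scalar unitrX // unitfE.
- move=> g h /GP [ug Pg] /GP [uh Ph]; apply/GP; split; last exact: Pm.
  by rewrite unitmx_mul ug.
- by move=> g /GP [ug Pg]; apply/GP; rewrite unitmx_inv; split => //; exact: Pv.
- move=> g cg ug; apply/GP; split => //; apply: Pc => B /cg [h [/GP [_ Ph] Bh]].
  by exists h.
Qed.

Lemma row_stable_closed i : mx_subgroup_closed (row_stable i).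
Proof.
split; first exact: row_stable_scalar.
- exact: row_stableM.
- exact: row_stableV.
- move=> g cg j ji; apply: closure_entry0 cg => h; exact.
Qed.

Lemma Ht_closed :
  mx_subgroup_closed [set h | row_stable i0 h /\ col_stable iN h].
Proof.
split.
- by move=> a; split; [exact: row_stable_scalar|exact: col_stable_scalar].
- by move=> g h [rg cg] [rh ch]; split; [exact: row_stableM|exact: col_stableM].
- by move=> g ug [rg cg]; split; [exact: row_stableV|exact: col_stableV].
- move=> g cg; split => j ji.
    by apply: closure_entry0 cg => h [rh _]; exact: rh.
  rewrite mxE; apply: closure_entry0 cg => h [_ ch].
  by have := ch j ji; rewrite mxE.
Qed.

Lemma Gt_matrix_subgroup : matrix_subgroup (Gt_group R m).
Proof. exact: closed_matrix_subgroup (row_stable_closed i0) Gt_groupP. Qed.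

Lemma Ht_matrix_subgroup : matrix_subgroup (Ht_group R m).
Proof.
apply: closed_matrix_subgroup Ht_closed _ => g.
by split=> [/Ht_groupP[? ? ?]|[? [? ?]]] //; apply/Ht_groupP.
Qed.

Lemma Gt_Ht_klein_pair : klein_pair (Gt_group R m) (Ht_group R m).
Proof.
split; [exact: Gt_matrix_subgroup|exact: Ht_matrix_subgroup|].
by move=> h /Ht_groupP [uh rh _]; apply/Gt_groupP.
Qed.

Lemma Ht_sub_H : Ht_group R m `<=` H_group R m.
Proof. by move=> h /Ht_groupP [uh _ ch]; apply/H_groupP. Qed.

Lemma H_group1 : H_group R m 1%:M.
Proof. by apply/H_groupP; split; [exact: unitmx1|exact: col_stable_scalar]. Qed.

Lemma H_groupM h k : H_group R m h -> H_group R m k -> H_group R m (h *m k).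
Proof.
move=> /H_groupP [uh ch] /H_groupP [uk ck]; apply/H_groupP.
by rewrite unitmx_mul uh uk; split => //; exact: col_stableM.
Qed.

Lemma H_groupV h : H_group R m h -> H_group R m (invmx h).
Proof.
move=> /H_groupP [uh ch]; apply/H_groupP.
by rewrite unitmx_inv; split => //; exact: col_stableV.
Qed.

Lemma H_group_unit h : H_group R m h -> h \in unitmx.
Proof. by move=> /H_groupP[]. Qed.

(** [norm_jet u] and v are normal jets of the same H-orbit, hence equal. This identifies any normal
    frame of an orbit with the computed one. *)
Lemma norm_jet_uniq (u v : jet R m) h : normal v -> H_group R m h ->
  u = jet_mul v (H_jet h) -> norm_jet u = v.
Proof.
move=> nv Hh uE.
have uu : u.1 \in unitmx by rewrite uE /= (proj1 nv) mul1mx; exact: H_jet_unit.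
have Hn := norm_mx_group uu.
have E : norm_jet u = jet_mul v (H_jet (h *m norm_mx u)).
  by rewrite H_jetM // jet_mulA -uE.
rewrite E; apply: normal_unique => //; first exact: H_groupM.
by rewrite -E; exact: norm_jet_normal.
Qed.

(* 1 + v e_0, with v in the hyperplane, acts trivially on it. *)
Lemma Gt_Ht_not_effective : ~ effective (Gt_group R m) (Ht_group R m).
Proof.
pose E : MN := delta_mx iN i0.
have rE : row_stable i0 E by move=> j ji; rewrite mxE i0N.
have E2 : E *m E = 0.
  by rewrite /E mul_delta_mx_cond i0N mulr0n.
have rs1E : row_stable i0 (1%:M + E).
  by apply: row_stableD => //; exact: row_stable_scalar.
have u1E : 1%:M + E \in unitmx.
  suff /mulmx1_unit[] : (1%:M + E) *m (1%:M - E) = 1%:M by [].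
  by rewrite mulmxDl !mulmxBr !mul1mx mulmx1 E2 subr0 subrK.
move=> /(_ (1%:M + E)) []; first exact/Gt_groupP.
  move=> k /Gt_groupP [uk rk].
  have uki : invmx k \in unitmx by rewrite unitmx_inv.
  apply/Ht_groupP; split; first by rewrite !unitmx_mul uki u1E uk.
    by do 2 ?apply: row_stableM => //; exact: row_stableV.
  rewrite mulmxDr mulmx1 mulmxDl mulVmx //.
  apply: col_stableD; first exact: col_stable_scalar.
  have -> : E = delta_mx iN 0 *m (delta_mx 0 i0 : 'rV_(n + 1)) by rewrite mul_delta_mx.
  (* The form e_0 is an eigenvector of k, so the conjugate of E is a column times e_0 and its column
     [iN] vanishes. *)
  rewrite -!mulmxA (row_stableP _ _).1 //.
  move=> j jN; rewrite mxE -scalemxAr -scalemxAr mxE mulmxA mxE big1 ?mulr0 //.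
  by move=> l _; rewrite [X in _ * X]mxE [iN == _]eq_sym i0N andbF mulr0.
move=> a /matrixP /(_ iN i0); rewrite !mxE !eqxx [iN == _]eq_sym i0N /= !mulr0n add0r.
by move=> /eqP; rewrite oner_eq0.
Qed.

End Groups.

(** * Flat jets *)

Section FlatJets.
Variables (R : realType) (m : nat).
Local Notation n := m.+1.
Local Notation MN := 'M[R]_(n + 1).
Local Notation jet := (jet R m).
Implicit Types u a : jet.

(* 2-jets of maps preserving {x^0 = 0} to second order along it. *)
Definition flat u : Prop := row_stable ord0 u.1 /\
  forall j k, j != ord0 -> k != ord0 -> jet2 u ord0 j k = 0.

(** For nonzero j, k the entries a^0_j and a^0_k vanish, which leaves u^0_{ll'} with l, l' nonzero;
    in the other sum u^0_l leaves l = 0 only, where a^0_{jk} vanishes. *)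
Lemma flat_mul u a : flat u -> flat a -> flat (jet_mul u a).
Proof.
move=> [u1 u2] [a1 a2]; split; first exact: row_stableM.
move=> j k j0 k0; rewrite jet2_mul !big1 ?addr0 //.
  move=> l _; apply: big1 => l' _.
  have [->|l0] := eqVneq l ord0; first by rewrite a1 // mulr0 mul0r.
  have [->|l0'] := eqVneq l' ord0; first by rewrite (a1 k) // mulr0.
  by rewrite u2 // !mul0r.
move=> l _; have [->|l0] := eqVneq l ord0; first by rewrite a2 // mulr0.
by rewrite u1 // mul0r.
Qed.

Lemma row_stable_block (A : 'M[R]_n) (Y : 'rV[R]_n) (a : R) :
  row_stable (i0 m) (block_mx A 0 Y a%:M) <-> row_stable ord0 A.
Proof.
split=> rA j j0.
  have := rA (lshift 1 j); rewrite block_mxEul; apply.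
  by rewrite (inj_eq (@lshift_inj _ _)).
move: j0; case: (split_ordP j) => k ->; last by rewrite block_mxEur mxE.
by rewrite (inj_eq (@lshift_inj _ _)) block_mxEul; exact: rA.
Qed.

(** Each term of the second-order part in row 0 carries a factor A_0j or A_0k. *)
Lemma Ht_jet_flat h : Ht_group R m h -> flat (H_jet h).
Proof.
move=> Hh; have [uh + _] := (Ht_groupP h).1 Hh.
have [A [Y [a [uA a0 ->]]]] := Ht_sub_H Hh.
move=> /row_stable_block rA; rewrite H_jet_block; split.
  exact: row_stableZ.
by move=> j k j0 k0; rewrite jet2E !rA // !mul0r addr0 mulr0.
Qed.

(** The fibre coordinate: it carries the normal form back to u, so a frame of P reading u is sigma_x
    . [eta_mx u]. *)
Definition eta_mx u : MN := invmx (norm_mx u).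

Lemma eta_mx_group u : u.1 \in unitmx -> H_group R m (eta_mx u).
Proof. by move=> uu; apply: H_groupV; exact: norm_mx_group. Qed.

Lemma norm_eta u : u.1 \in unitmx -> jet_mul (norm_jet u) (H_jet (eta_mx u)) = u.
Proof.
move=> uu; have Hn := norm_mx_group uu.
rewrite /norm_jet -jet_mulA -H_jetM //; last exact: eta_mx_group.
rewrite mulmxV ?H_jet_scalar ?oner_neq0 ?jet_mul1 //.
exact: H_group_unit.
Qed.

(** The second derivatives of u enter only the last row of [norm_mx u], on which H~ puts no
    condition beyond a nonzero last entry. *)
Lemma eta_mx_Ht u : u.1 \in unitmx -> row_stable ord0 u.1 ->
  Ht_group R m (eta_mx u).
Proof.
move=> uu ru; have Hn := norm_mx_group uu.
have [ue ce] := (H_groupP _).1 (eta_mx_group uu).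
apply/Ht_groupP; split => //; apply: row_stableV; first exact: H_group_unit.
by apply/row_stable_block; exact: row_stableV.
Qed.

Lemma norm_mx_Ht u : u.1 \in unitmx -> row_stable ord0 u.1 ->
  Ht_group R m (norm_mx u).
Proof.
move=> uu ru; have := norm_mx_group uu => /H_groupP [un cn].
by apply/Ht_groupP; split => //; apply/row_stable_block; exact: row_stableV.
Qed.

Lemma findim_jet : @findim R (jet : normedModType R).
Proof. by apply: findim_prod; exact: findim_mx. Qed.

Variable V : normedModType R.

Lemma smoothat_jet (f : V -> jet) x :
  smoothat x (fun y => (f y).1) ->
  (forall i j k, smoothat x (fun y => jet2 (f y) i j k)) -> smoothat x f.
Proof.
move=> s1 s2; apply: (@smoothat_ext _ _ _ _ (fun y => ((f y).1, (f y).2))).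
  by move=> y; case: (f y).
apply: smoothat_pair => //; apply: smoothat_mx => i jk.
by case/mxvec_indexP: jk => j k; exact: s2.
Qed.

Lemma smoothat_jet2 (f : V -> jet) x i j k : smoothat x f ->
  smoothat x (fun y => jet2 (f y) i j k).
Proof. by move=> sf; apply: smoothat_coord; exact: smoothat_snd. Qed.

Lemma smoothat_jet1 (f : V -> jet) x i j : smoothat x f ->
  smoothat x (fun y => (f y).1 i j).
Proof. by move=> sf; apply: smoothat_coord; exact: smoothat_fst. Qed.

Lemma smoothat_jet_mul (f g : V -> jet) x : smoothat x f -> smoothat x g ->
  smoothat x (fun y => jet_mul (f y) (g y)).
Proof.
move=> sf sg; apply: smoothat_jet => [|i j k].
  by apply: smoothat_mulmx; exact: smoothat_fst.
apply: (@smoothat_ext _ _ _ _ (fun y => \sum_l (f y).1 i l * jet2 (g y) l j k +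
  \sum_l \sum_l' jet2 (f y) i l l' * (g y).1 l j * (g y).1 l' k)).
  by move=> y; rewrite jet2_mul.
apply: smoothat_add; apply: smoothat_sum => l _.
  by apply: smoothat_mul; [exact: smoothat_jet1|exact: smoothat_jet2].
apply: smoothat_sum => l' _; apply: smoothat_mul; last exact: smoothat_jet1.
by apply: smoothat_mul; [exact: smoothat_jet2|exact: smoothat_jet1].
Qed.

(** The formula is polynomial in the entries and the inverse of the last one, which is nonzero near
    x. Thus f itself may leave H away from x. *)
Lemma smoothat_H_jet (f : V -> MN) x : H_group R m (f x) -> smoothat x f ->
  smoothat x (fun y => H_jet (f y)).
Proof.
move=> [A [Y [a [uA a0 fE]]]] sf.
have sa : smoothat x (fun y => (f y (iN m) (iN m))^-1).
  apply: smoothat_inv; last exact: smoothat_coord.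
  by rewrite fE block_mxEdr mxE eqxx.
apply: smoothat_jet => [|i j k].
  apply: smoothat_mx => i j.
  apply: (@smoothat_ext _ _ _ _ (fun y => (f y (iN m) (iN m))^-1 *
      f y (lshift 1 i) (lshift 1 j))).
    by move=> y; rewrite !mxE.
  by apply: smoothat_mul => //; exact: smoothat_coord.
apply: (@smoothat_ext _ _ _ _ (fun y => - (
   ((f y (iN m) (iN m))^-1 * f y (lshift 1 i) (lshift 1 j)) *
   ((f y (iN m) (iN m))^-1 * f y (iN m) (lshift 1 k)) +
   ((f y (iN m) (iN m))^-1 * f y (lshift 1 i) (lshift 1 k)) *
   ((f y (iN m) (iN m))^-1 * f y (iN m) (lshift 1 j))))).
  by move=> y; rewrite jet2E !mxE.
apply: smoothat_opp; apply: smoothat_add;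
  by do 2 ?apply: smoothat_mul => //; exact: smoothat_coord.
Qed.

Lemma smoothat_norm_mx (f : V -> jet) x : (f x).1 \in unitmx -> smoothat x f ->
  smoothat x (fun y => norm_mx (f y)).
Proof.
move=> ux sf.
have si : smoothat x (fun y => invmx (f y).1).
  by apply: smoothat_invmx => //; exact: smoothat_fst.
apply: smoothat_mx => i j; case: (split_ordP i) => k ->; case: (split_ordP j) => l ->.
- apply: (@smoothat_ext _ _ _ _ (fun y => invmx (f y).1 k l)).
    by move=> y; rewrite block_mxEul.
  exact: smoothat_coord.
- apply: (@smoothat_ext _ _ _ _ (fun=> 0)); last exact: smoothat_cst.
  by move=> y; rewrite block_mxEur mxE.
- apply: (@smoothat_ext _ _ _ _ (fun y => n.+1%:R^-1 *
    \sum_i \sum_a \sum_b jet2 (f y) i a b * invmx (f y).1 a i * invmx (f y).1 b l)).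
    by move=> y; rewrite block_mxEdl mxE.
  apply: smoothat_mul; first exact: smoothat_cst.
  apply: smoothat_sum => i' _; apply: smoothat_sum => a _; apply: smoothat_sum => b _.
  apply: smoothat_mul; last exact: smoothat_coord.
  by apply: smoothat_mul; [exact: smoothat_jet2|exact: smoothat_coord].
- apply: (@smoothat_ext _ _ _ _ (fun=> (1%:M : 'M[R]_1) k l)); last exact: smoothat_cst.
  by move=> y; rewrite block_mxEdr.
Qed.

Lemma smoothat_norm_jet (f : V -> jet) x : (f x).1 \in unitmx -> smoothat x f ->
  smoothat x (fun y => norm_jet (f y)).
Proof.
move=> ux sf; apply: smoothat_jet_mul => //; apply: smoothat_H_jet.
  exact: norm_mx_group.
exact: smoothat_norm_mx.
Qed.

Lemma smoothat_eta_mx (f : V -> jet) x : (f x).1 \in unitmx -> smoothat x f ->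
  smoothat x (fun y => eta_mx (f y)).
Proof.
move=> ux sf; apply: smoothat_invmx; last exact: smoothat_norm_mx.
by apply: H_group_unit; exact: norm_mx_group.
Qed.

End FlatJets.

(** * Curves *)

Section Curves.
Variable R : realType.
Implicit Types V W : normedModType R.

Lemma derive_right V W (f : V -> W) x v : differentiable f x ->
  'D_v f x = lim (h^-1 *: (f (h *: v + x) - f x) @[h --> (0 : R)^'+]).
Proof.
move=> df; rewrite -cvg_at_rightE //.
exact: (diff_derivable df).
Qed.

(** Curves are compared with their smooth representatives for t >= 0 only; a differentiable function
    has its derivative at 0 determined by these times. *)
Lemma derive1_right_eq V (f g : R -> V) : differentiable f (0 : R) ->
  differentiable g (0 : R) ->
  (\forall t \near (0 : R), 0 <= t -> f t = g t) -> derive1 f 0 = derive1 g 0.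
Proof.
move=> df dg fg; rewrite !derive1E !derive_right //.
have fg0 : f 0 = g 0 by apply: (nbhs_singleton fg).
have E (t : R) : t *: (1 : R) + 0 = t by rewrite addr0 -[LHS]/(t * 1) mulr1.
have H : \forall t \near (0 : R)^'+, f t = g t.
  by apply: filterS fg => t ft t0; exact: ft (ltW t0).
by congr (lim _); rewrite eqEsubset; split; apply/near_eq_cvg;
  apply: filterS H => t ft; rewrite E fg0 ft.
Qed.

Lemma derive1_clin V W (L : V -> W) (f : R -> V) (t : R) : clin L ->
  differentiable f t -> derive1 (fun t => L (f t)) t = L (derive1 f t).
Proof. by move=> cL df; rewrite !derive1E -derive_clin. Qed.

Lemma derive1_pair V W (f : R -> V) (g : R -> W) (t : R) :
  differentiable f t -> differentiable g t ->
  derive1 (fun t => (f t, g t)) t = (derive1 f t, derive1 g t).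
Proof.
move=> df dg; have dfg := differentiable_pair df dg.
rewrite [LHS]surjective_pairing -(derive1_clin (@clin_fst R V W) dfg).
by rewrite -(derive1_clin (@clin_snd R V W) dfg).
Qed.

Lemma derive1_line V W (f : V -> W) x v : differentiable f x ->
  derive1 (fun t : R => f (x + t *: v)) 0 = 'D_v f x.
Proof.
move=> df; rewrite derive1E /derive.
suff E : (fun h : R => h^-1 *: (((fun t : R => f (x + t *: v)) \o shift 0)
    (h *: (1 : R)) - f (x + 0 *: v))) =
    (fun h : R => h^-1 *: ((f \o shift x) (h *: v) - f x)) by rewrite E.
apply/funext => h.
by rewrite /= !addr0 scale0r addr0 -[h *: 1]/(h * 1) mulr1 [_ + x]addrC.
Qed.

(** The general Leibniz rule: the differential at (1, 1) is the sum of its values at (1, 0) and (0,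
    1). *)
Lemma derive1_diag V (F : R * R -> V) : differentiable F (0, 0) ->
  derive1 (fun t => F (t, t)) 0 =
  derive1 (fun t => F (t, 0)) 0 + derive1 (fun t => F (0, t)) 0.
Proof.
move=> dF.
have E (a b : R) : derive1 (fun t : R => F (t * a, t * b)) 0 = 'd F (0, 0) (a, b).
  rewrite -deriveE // -derive1_line //; congr (derive1 _ _).
  by apply/funext => t; congr F; congr pair; rewrite /= add0r.
have := E 1 1; have := E 1 0; have := E 0 1.
rewrite (_ : (fun t => _) = fun t => F (0, t)); last first.
  by apply/funext => t; rewrite mulr0 mulr1.
move=> ->; rewrite (_ : (fun t => _) = fun t => F (t, 0)); last first.
  by apply/funext => t; rewrite mulr0 mulr1.
move=> ->; rewrite (_ : (fun t => _) = fun t => F (t, t)); last first.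
  by apply/funext => t; rewrite mulr1.
move=> ->; rewrite -linearD; congr ('d F _ _).
by congr pair; rewrite /= ?addr0 ?add0r.
Qed.

Lemma smoothat_line V (x v : V) (t : R) : smoothat t (fun t : R => x + t *: v).
Proof.
apply: smoothat_add; first exact: smoothat_cst.
exact: (smoothat_clin t (clin_scale v)).
Qed.

Lemma near_line V (x v : V) (P : set V) : (\forall y \near x, P y) ->
  \forall t \near (0 : R), P (x + t *: v).
Proof.
have := smoothat_continuous (smoothat_line x v 0).
by rewrite scale0r addr0 => cx /cx.
Qed.

Lemma derive_local_min V (f : V -> R) x v : smoothat x f ->
  (\forall y \near x, f x <= f y) -> 'D_v f x = 0.
Proof.
move=> sf fx; rewrite -derive1_line; last exact: smoothat_differentiable.
have [ e /= e0 He] := near_line v (filterI fx (smoothat_near sf)).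
have He' (t : R) : t \in `]- e, e[%R ->
    f x <= f (x + t *: v) /\ smoothat (x + t *: v) f.
  by rewrite in_itv /= -ltr_norml => te; apply: He; rewrite /= sub0r normrN.
have oo : (0 : R) \in `]- e, e[%R by rewrite in_itv /= oppr_lt0 e0.
rewrite derive1E.
have [] := @derive1_at_min _ (fun t => f (x + t *: v)) (- e) e 0 _ _ oo _ => //.
- by rewrite ltW // gtrN.
- move=> t /He' [_ st]; apply: diff_derivable; apply: differentiable_comp.
    exact: smoothat_differentiable (smoothat_line _ _ _).
  exact: smoothat_differentiable.
- by move=> t /He' [+ _]; rewrite scale0r addr0.
Qed.

Lemma derive1_line_id V (x v : V) : derive1 (fun t : R => x + t *: v) 0 = v.
Proof. by rewrite (@derive1_line V V id) // derive_id. Qed.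

(** The germ form of a velocity, with the bound e absorbed in the filter at 0, so that finitely many
    local conditions can be intersected. *)
Lemma velocityP (X : charted R) (A : set X) (gam : R -> X) p c v :
  velocity A gam p c v <->
  [/\ gam 0 = p, dom c p & exists g : R -> model X,
    [/\ smoothat (0 : R) g, \forall t \near (0 : R), 0 <= t ->
          [/\ A (gam t), dom c (gam t) & coord c (gam t) = g t] &
        v = derive1 g 0]].
Proof.
split=> [[g0 dp [e [g [e0 sg gE vE]]]]|[g0 dp [g [sg gE vE]]]]; split=> //.
  exists g; split => //.
    apply: smooth_smoothat sg; last by rewrite /= normr0.
    rewrite (_ : [set t : R^o | _] = ball (0 : R^o) e); first exact: ball_open.
    by apply/seteqP; split => t; rewrite -ball_normE /= sub0r normrN.
  near=> t => t0; apply: gE => //.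
  by rewrite -[t]ger0_norm //; near: t; exact: nbhs0_lt.
have [ O [oO O0 sO]] := sg.
have [e /= e0 He] : \forall t \near (0 : R), O t /\ (0 <= t ->
          [/\ A (gam t), dom c (gam t) & coord c (gam t) = g t]).
  by apply: filterI => //; exact: open_nbhs_nbhs.
have Hb t : `|t| < e -> O t /\ (0 <= t ->
          [/\ A (gam t), dom c (gam t) & coord c (gam t) = g t]).
  by move=> te; apply: He; rewrite /= sub0r normrN.
exists e, g; split => //.
  by move=> k; apply: Ck_sub (sO k) => t /= /Hb [].
move=> t t0 te; have [|_] := Hb t; first by rewrite ger0_norm.
exact.
Unshelve. all: by end_near. Qed.

End Curves.

(** * Charts and coordinate changes *)

Section Charts.
Variables (R : realType) (m : nat) (M : bmanifold R m).
Local Notation n := m.+1.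
Implicit Types (c : mchart M) (p q : M).

Lemma chart_inj c p q : mdom c p -> mdom c q -> mcoord c p = mcoord c q -> p = q.
Proof.
by have [_ + _ _] := mchart_top c => inj cp cq; apply: inj; rewrite inE.
Qed.

(** The image of an open set is open relative to the half-space: this produces points with
    prescribed coordinates. *)
Lemma near_chart c p (V : set M) : open V -> V p -> mdom c p ->
  \forall x \near mcoord c p, half_space x ->
    exists q, [/\ mdom c q, V q & mcoord c q = x].
Proof.
move=> oV Vp cp; have [oU _ _ im] := mchart_top c.
have [|O oO OE] := im (mdom c `&` V) _ (openI oU oV); first by move=> q [].
have Op : O (mcoord c p).
  suff: (O `&` half_space (m := m)) (mcoord c p) by case.
  by rewrite -OE; exists p.
apply: filterS (open_nbhs_nbhs (conj oO Op)) => x Ox hx.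
suff [q [cq Vq] <-] : (mcoord c @` (mdom c `&` V)) x by exists q.
by rewrite OE.
Qed.

Lemma chart_half c p : mdom c p -> 0 <= mcoord c p 0 ord0.
Proof.
move=> cp; have [oU _ _ im] := mchart_top c.
have [|O oO OE] := im (mdom c) _ oU; first by [].
suff: (O `&` half_space (m := m)) (mcoord c p) by case.
by rewrite -OE; exists p.
Qed.

(** By injectivity of the chart, coordinates close to those of p belong only to points of V. *)
Lemma near_chart_dom c p (V : set M) : open V -> V p -> mdom c p ->
  \forall x \near mcoord c p, forall q, mdom c q -> mcoord c q = x -> V q.
Proof.
move=> oV Vp cp; apply: filterS (near_chart oV Vp cp) => x H q cq qx.
have [|q' [cq' Vq' q'x]] := H; first by rewrite -qx /half_space /=; exact: chart_half.
by rewrite (@chart_inj c q q') // qx q'x.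
Qed.

Lemma chart_open c : open (mdom c).
Proof. by have [] := mchart_top c. Qed.

Lemma chart_preimage_open c O : open O -> open (mdom c `&` mcoord c @^-1` O).
Proof. by have [_ _ + _] := mchart_top c => H; exact: H. Qed.

Lemma chart_invE c p q : mdom c q -> chart_inv c p (mcoord c q) = q.
Proof.
move=> cq; rewrite /chart_inv; set S := [set q' | _].
have : S (xget p S) by apply: (@xgetPex _ p S); exists q.
by case=> cq' E; exact: chart_inj E.
Qed.

(** Local formulas in a chart are stated from here on for every q with coordinates x, x near those
    of p; when x lies outside the half-space, nothing is asserted. *)
Lemma chart_transition c c' p : mdom c p -> mdom c' p ->
  exists g : 'rV[R]_n -> 'rV[R]_n,
    smoothat (mcoord c p) g /\
    \forall x \near mcoord c p, forall q, mdom c q -> mcoord c q = x ->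
      mdom c' q /\ mcoord c' q = g x.
Proof.
move=> cp cp'; have [ O [g [oO Op sg gE]]] := mchart_smooth (c := c) (c' := c') cp cp'.
exists g; split; first exact: smooth_smoothat sg.
apply: filterS2 (open_nbhs_nbhs (conj oO Op))
  (near_chart_dom (@chart_open c') cp' cp) => x Ox H q cq qx.
have cq' := H q cq qx; split => //.
by rewrite -qx; apply: gE => //; rewrite qx.
Qed.

(** For h > 0 the point x + h e_a stays in the half-space, even for a = 0, so the quotients of f and
    of its extension g agree on the side that defines [pderiv]. *)
Lemma pderivE c a (f : M -> R) (g : 'rV[R]_n -> R) q : mdom c q ->
  differentiable g (mcoord c q) ->
  (\forall x \near mcoord c q, forall q', mdom c q' -> mcoord c q' = x ->
     f q' = g x) ->
  pderiv c a f q = 'D_(delta_mx 0 a) g (mcoord c q).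
Proof.
move=> cq dg fg; rewrite derive_right // /pderiv.
have fgq : f q = g (mcoord c q) by apply: (nbhs_singleton fg).
have H : \forall h \near (0 : R)^'+,
    h^-1 * (f (chart_inv c q (mcoord c q + h *: delta_mx 0 a)) - f q) =
    h^-1 *: (g (h *: delta_mx 0 a + mcoord c q) - g (mcoord c q)).
  have H1 := near_line (delta_mx 0 a) fg.
  have H2 := near_line (delta_mx 0 a) (near_chart openT I cq).
  suff: \forall h \near (0 : R), 0 < h ->
    h^-1 * (f (chart_inv c q (mcoord c q + h *: delta_mx 0 a)) - f q) =
    h^-1 *: (g (h *: delta_mx 0 a + mcoord c q) - g (mcoord c q)) by [].
  apply: filterS2 H2 H1 => h Hh Hf h0.
  have [|q' [cq' _ q'E]] := Hh.
    rewrite /half_space /= !mxE eqxx /= addr_ge0 ?chart_half //.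
    by rewrite mulr_ge0 // ?ler0n // ltW.
  by rewrite -q'E chart_invE // (Hf q') // fgq [h *: _ + _]addrC.
by congr (lim _); rewrite eqEsubset; split; apply/near_eq_cvg;
  apply: filterS H => h ->.
Qed.

Definition map_jet (g : 'rV[R]_n -> 'rV[R]_n) (x : 'rV[R]_n) : jet R m :=
  mk_jet (\matrix_(i, j) 'D_(delta_mx 0 j) (fun y => g y 0 i) x)
    (fun i j k => 'D_(delta_mx 0 j) ('D_(delta_mx 0 k) (fun y => g y 0 i)) x).

Lemma smoothat_map_jet g x : smoothat x g -> smoothat x (map_jet g).
Proof.
move=> sg; have sgi i : smoothat x (fun y => g y 0 i) by exact: smoothat_coord.
apply: smoothat_jet => [|i j k].
  apply: smoothat_mx => i j.
  apply: (@smoothat_ext _ _ _ _ ('D_(delta_mx 0 j) (fun y => g y 0 i))).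
    by move=> y; rewrite mxE.
  exact: smoothat_derive.
apply: (@smoothat_ext _ _ _ _
  ('D_(delta_mx 0 j) ('D_(delta_mx 0 k) (fun y => g y 0 i)))).
  by move=> y; rewrite jet2E.
by do 2 apply: smoothat_derive.
Qed.

(** Equality is needed near p and not only at p: the second derivatives are derivatives of the first
    ones, which must first be identified on a neighbourhood. *)
Lemma transition_jetE c c' p (g : 'rV[R]_n -> 'rV[R]_n) : mdom c p ->
  smoothat (mcoord c p) g ->
  (\forall x \near mcoord c p, forall q, mdom c q -> mcoord c q = x ->
      mdom c' q /\ mcoord c' q = g x) ->
  \forall x \near mcoord c p, forall q, mdom c q -> mcoord c q = x ->
    transition_jet c c' q = map_jet g x.
Proof.
move=> cp sg gE.
have sgi i x : smoothat x g -> smoothat x (fun y => g y 0 i).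
  by move=> sgx; exact: smoothat_coord.
have D1 : \forall x \near mcoord c p, smoothat x g /\
    forall q, mdom c q -> mcoord c q = x -> forall i k,
    pderiv c k (fun q => mcoord c' q 0 i) q = 'D_(delta_mx 0 k) (fun y => g y 0 i) x.
  apply: filterS (near_join (filterI (smoothat_near sg) gE)) => x Hx.
  have [sx _] := nbhs_singleton Hx; split=> // q cq qx i k; rewrite -qx; apply: pderivE => //.
    by apply: smoothat_differentiable; apply: sgi; rewrite qx.
  rewrite qx; apply: filterS Hx => y [_ Hy] q' cq' q'y.
  by have [_ ->] := Hy _ cq' q'y.
apply: filterS (near_join D1) => x Hx q cq qx; have [sx Dx] := nbhs_singleton Hx.
apply: jet_ext => [|i j k]; first by apply/matrixP => i j; rewrite !mxE Dx.
rewrite !jet2E -qx; apply: pderivE => //.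
  apply: smoothat_differentiable; apply: smoothat_derive; apply: sgi.
  by rewrite qx.
rewrite qx; apply: filterS Hx => y [_ Hy] q' cq' q'y.
exact: Hy.
Qed.

(* If c' read p in the interior, the first coordinate of the transition from c'
   to c would have a local minimum at p, hence zero derivative there; composing
   with the transition from c to c' gives a contradiction. *)
Lemma bd_coord0 c c' p : mdom c p -> mdom c' p ->
  mcoord c p 0 ord0 = 0 -> mcoord c' p 0 ord0 = 0.
Proof.
move=> cp cp' p0; apply: contrapT => /eqP p'0.
have p'_gt0 : 0 < mcoord c' p 0 ord0 by rewrite lt_def p'0 chart_half.
have [g [sg gE]] := chart_transition cp cp'.
have [g' [sg' gE']] := chart_transition cp' cp.
have gp : mcoord c' p = g (mcoord c p) by have [] := nbhs_singleton gE p cp erefl.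
have gp' : mcoord c p = g' (mcoord c' p) by have [] := nbhs_singleton gE' p cp' erefl.
pose f y := g' y 0 ord0.
have sf : smoothat (mcoord c' p) f by exact: smoothat_coord.
have df := smoothat_differentiable sf.
(* Around an interior reading every y is read by some point, and f y is the coordinate x^0 of that
   point in c. *)
have f_ge0 : \forall y \near mcoord c' p, f (mcoord c' p) <= f y.
  have pos : \forall y \near mcoord c' p, 0 < (y : 'rV[R]_n) 0 ord0.
    have cc : ((y : 'rV[R]_n) 0 ord0) @[y --> mcoord c' p] --> mcoord c' p 0 ord0.
      exact: coord_continuous.
    by apply: (cc [set t | 0 < t]); apply: open_nbhs_nbhs; split => //; exact: open_gt.
  apply: filterS3 pos gE' (near_chart (@chart_open c) cp cp') => y y0 Hy [|q [cq' cq qy]].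
    by rewrite /half_space /= ltW.
  have [_ qy'] := Hy q cq' qy.
  by rewrite {1}/f -gp' p0 /f -qy' chart_half.
have Df0 v : 'D_v f (mcoord c' p) = 0 by exact: derive_local_min.
pose e : 'rV[R]_n := delta_mx 0 ord0.
have dg := smoothat_differentiable sg.
have dfg : differentiable (f \o g) (mcoord c p).
  by apply: differentiable_comp => //; rewrite -gp.
have : 'D_e (f \o g) (mcoord c p) = 0.
  by rewrite deriveE // diff_comp -?gp //= -deriveE.
rewrite -derive1_line //.
(* The two transitions are known to be inverse only at coordinates of actual points, that is for t
   >= 0 along e; this side is enough. *)
have -> : derive1 (fun t : R => (f \o g) (mcoord c p + t *: e)) 0 =
          derive1 (fun t : R => (mcoord c p + t *: e) 0 ord0) 0.
  have sl := smoothat_line (mcoord c p) e 0.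
  apply: derive1_right_eq.
  - apply: differentiable_comp; first exact: smoothat_differentiable.
    by rewrite scale0r addr0.
  - by apply: smoothat_differentiable; exact: smoothat_coord.
  have gE2 : \forall x \near mcoord c p, forall q, mdom c q -> mcoord c q = x ->
      mcoord c q = g' (g x).
    have H : \forall x \near mcoord c p, forall q, mdom c' q -> mcoord c' q = g x ->
               mdom c q /\ mcoord c q = g' (g x).
      by have cg := smoothat_continuous sg; rewrite -gp in cg; exact: (cg _ gE').
    apply: filterS2 H gE => x Hx gx q cq qx.
    by have [cq' q'x] := gx q cq qx; have [] := Hx q cq' q'x.
  apply: filterS2 (near_line e gE2) (near_line e (near_chart (@chart_open c) cp cp)).
  move=> t Ht Hq t0; have [|q [cq _ qx]] := Hq.
    by rewrite /half_space /= !mxE p0 add0r mulr1.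
  by rewrite /= /f -(Ht q cq qx) qx.
rewrite (derive1_clin (clin_coord 0 ord0)); last first.
  exact: smoothat_differentiable (smoothat_line _ _ _).
by rewrite derive1_line_id mxE !eqxx => /eqP; rewrite oner_eq0.
Qed.

Lemma bd_coord c p : mdom c p -> bd p <-> mcoord c p 0 ord0 = 0.
Proof.
move=> cp; split; last by exists c.
by move=> [c' cp' p0]; exact: bd_coord0 p0.
Qed.

Lemma all_boundary_chart c : boundary_chart c.
Proof. by move=> p cp; exact: bd_coord. Qed.

(** Increments along e_k stay in the hyperplane, so the difference quotients are 0 near 0. *)
Lemma derive_hyperplane0 (f : 'rV[R]_n -> R) (x : 'rV[R]_n) k :
  k != ord0 -> x 0 ord0 = 0 ->
  (\forall y \near x, (y : 'rV[R]_n) 0 ord0 = 0 -> f y = 0) ->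
  'D_(delta_mx 0 k) f x = 0.
Proof.
move=> k0 x0 f0; rewrite /derive.
have fx : f x = 0 by exact: (nbhs_singleton f0).
suff H : \forall h \near (0 : R)^',
    h^-1 *: ((f \o shift x) (h *: delta_mx 0 k) - f x) = 0.
  by apply: lim_near_cst => //; exact: norm_hausdorff.
suff: \forall h \near (0 : R), h != 0 ->
    h^-1 *: ((f \o shift x) (h *: delta_mx 0 k) - f x) = 0 by [].
apply: filterS (near_line (delta_mx 0 k) f0) => h /= Hh h0.
rewrite /= [h *: _ + x]addrC Hh ?fx ?subr0 ?scaler0 //.
by rewrite !mxE x0 eqxx eq_sym (negPf k0) mulr0 addr0.
Qed.

Lemma map_jet_flat (g : 'rV[R]_n -> 'rV[R]_n) (x : 'rV[R]_n) : x 0 ord0 = 0 ->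
  (\forall y \near x, (y : 'rV[R]_n) 0 ord0 = 0 -> g y 0 ord0 = 0) -> flat (map_jet g x).
Proof.
move=> x0 g0; split=> [j j0|j k j0 k0]; first by rewrite mxE derive_hyperplane0.
rewrite jet2E derive_hyperplane0 //.
(* The first derivative vanishes along the hyperplane near x, so the same argument applies to it. *)
apply: filterS (near_join g0) => y Hy y0.
exact: derive_hyperplane0.
Qed.

End Charts.

(** * The bundles P and Q *)

Section Frames.
Variables (R : realType) (m : nat) (M : bmanifold R m).
Local Notation n := m.+1.
Local Notation MN := 'M[R]_(n + 1).
Local Notation H := (H_group R m).
Local Notation Ht := (Ht_group R m).
Implicit Types (c : mchart M) (p : M) (q : frames M) (h : MN).

Lemma transition_flat c c' p : mdom c p -> mdom c' p -> bd p ->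
  flat (transition_jet c c' p).
Proof.
move=> cp cp' bp; have [g [sg gE]] := chart_transition cp cp'.
rewrite (nbhs_singleton (transition_jetE cp sg gE) p cp erefl).
have p0 := (bd_coord cp).1 bp; apply: map_jet_flat => //.
apply: filterS2 gE (near_chart (@chart_open _ _ _ c) cp cp) => x gx Hx x0.
have [|q [cq _ qx]] := Hx; first by rewrite /half_space /= x0.
have [cq' <-] := gx q cq qx; apply/bd_coord => //.
by apply/(bd_coord cq); rewrite qx.
Qed.

Lemma transition_smooth c c' p : mdom c p -> mdom c' p ->
  exists J : 'rV[R]_n -> jet R m, smoothat (mcoord c p) J /\
    \forall x \near mcoord c p, forall q : M, mdom c q -> mcoord c q = x ->
      transition_jet c c' q = J x.
Proof.
move=> cp cp'; have [g [sg gE]] := chart_transition cp cp'.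
exists (map_jet g); split; first exact: smoothat_map_jet.
exact: transition_jetE.
Qed.

Lemma frame_ext q q' : q.1 = q'.1 -> (forall c, q.2 c = q'.2 c) -> q = q'.
Proof. by case: q q' => [p u] [p' u'] /= -> uu; congr pair; exact/funext. Qed.

(** One reading determines the frame: the chain rule gives the readings in the other charts at the
    point, and convention fixes the rest. *)
Lemma P2_eq c q q' : P2 q -> P2 q' -> q.1 = q'.1 -> mdom c q.1 ->
  q.2 c = q'.2 c -> q = q'.
Proof.
move=> [_ q0 qt] [_ q0' qt'] qq cq E; apply: frame_ext => // c'.
have [cq'|cq'] := pselect (mdom c' q.1); last by rewrite q0 // q0' -?qq.
by rewrite (qt c) // (qt' c) -?qq // E.
Qed.

(** The action preserves the conventional reading in charts that do not contain the point. *)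
Lemma jet_mul0 (a : jet R m) : jet_mul (0, 0) a = (0, 0).
Proof.
apply: jet_ext => [|i j k]; first by rewrite /= mul0mx.
rewrite jet2_mul {3}/jet2 /= mxE !big1 ?addr0 // => l _.
  by apply: big1 => l' _; rewrite /jet2 /= mxE !mul0r.
by rewrite mxE mul0r.
Qed.

Lemma invertible_jet_mul (u a : jet R m) :
  invertible_jet u -> invertible_jet a -> invertible_jet (jet_mul u a).
Proof.
move=> [u1 u2] [a1 a2]; split; first by rewrite unitmx_mul u1.
move=> i j k; rewrite !jet2_mul; congr (_ + _).
  by apply: eq_bigr => l _; rewrite a2.
rewrite exchange_big; apply: eq_bigr => l _; apply: eq_bigr => l' _.
by rewrite u2; ring.
Qed.

Lemma H_jet_invertible h : H h -> invertible_jet (H_jet h).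
Proof.
move=> Hh; split; first exact: H_jet_unit.
have [A [Y [a [_ _ ->]]]] := Hh.
by move=> i j k; rewrite H_jet_block !jet2E; ring.
Qed.

Lemma P2_act q h : P2 q -> H h -> P2 (frame_act q h).
Proof.
move=> [qi q0 qt] Hh; split => /= [c cq|c cq|c c' cq cq'].
- by apply: invertible_jet_mul; [exact: qi|exact: H_jet_invertible].
- by rewrite q0 // jet_mul0.
- by rewrite (qt c) // jet_mulA.
Qed.

Lemma frame_actM q h k : H h -> H k ->
  frame_act (frame_act q h) k = frame_act q (h *m k).
Proof.
by move=> Hh Hk; apply: frame_ext => //= c; rewrite -jet_mulA -H_jetM.
Qed.

Lemma frame_act_scalar q (a : R) : a != 0 -> frame_act q a%:M = q.
Proof.
by move=> a0; apply: frame_ext => //= c; rewrite H_jet_scalar // jet_mul1.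
Qed.

Lemma frame_actK q h : H h -> frame_act (frame_act q h) (invmx h) = q.
Proof.
move=> Hh; rewrite frame_actM //; last exact: H_groupV.
by rewrite mulmxV ?frame_act_scalar ?oner_neq0 //; exact: H_group_unit.
Qed.

Lemma H_orbit_act q h : H h -> H_orbit (frame_act q h) = H_orbit q.
Proof.
move=> Hh; apply/seteqP; split => [_ [k Hk <-]|_ [k Hk <-]].
  by exists (h *m k); [exact: H_groupM|rewrite frame_actM].
have HV := H_groupV Hh.
exists (invmx h *m k); first exact: H_groupM.
by rewrite -frame_actM // frame_actK.
Qed.

Lemma H_orbit_refl q : H_orbit q q.
Proof.
exists 1%:M; first exact: H_group1.
by rewrite frame_act_scalar ?oner_neq0.
Qed.

Lemma sum_delta2 (F : 'I_n -> 'I_n -> R) (j k : 'I_n) :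
  \sum_a \sum_b F a b * (1%:M : 'M[R]_n) a j * (1%:M : 'M[R]_n) b k = F j k.
Proof.
rewrite (bigD1 j) //= (bigD1 k) //= !mxE !eqxx !mulr1 !big1 ?addr0 //.
  by move=> l /negPf lj; apply: big1 => l' _; rewrite mxE lj mulr0 mul0r.
by move=> l /negPf lk; rewrite !mxE lk mulr0.
Qed.

(** This is the formula of the Thomas invariant: for a frame with identity linear part, normalising
    is the passage from Gamma to Pi. *)
Lemma jet2_norm1 (u : jet R m) (i j k : 'I_n) : u.1 = 1%:M -> jet2 (norm_jet u) i j k =
  jet2 u i j k - (n.+1%:R)^-1 * (\sum_l jet2 u l l k) * (i == j)%:R
               - (n.+1%:R)^-1 * (\sum_l jet2 u l l j) * (i == k)%:R.
Proof.
move=> u1; rewrite jet2_norm ?u1 ?unitmx1 // invmx1 sum_delta2 !mxE u1 invmx1.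
under eq_bigr do rewrite sum_delta2.
under [X in _ - (_ + _ * (_ * X))]eq_bigr do rewrite sum_delta2.
ring.
Qed.

Variable s : M -> set (frames M).
Hypothesis hs : projective_structure s.
Local Notation P := (Pbundle s).
Local Notation Q := (Qbundle s).

Lemma Pbundle_act q h : P q -> H h -> P (frame_act q h).
Proof.
by move=> [Pq sq] Hh; split; [exact: P2_act|rewrite H_orbit_act].
Qed.

Lemma Pbundle_s p q : s p q <-> P q /\ q.1 = p.
Proof.
split=> [|[[_ sq] <-]]; last by rewrite -sq; exact: H_orbit_refl.
have [q0 [Pq0 q0p sp]] := hs.1 p; rewrite sp => -[h Hh <-].
split => //; split; first exact: P2_act.
by rewrite H_orbit_act // -sp /= q0p.
Qed.

Lemma Pbundle_over p : exists q, P q /\ q.1 = p.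
Proof.
have [q0 [Pq0 q0p sp]] := hs.1 p; exists q0; apply/Pbundle_s.
by rewrite sp; exact: H_orbit_refl.
Qed.

Lemma Pbundle_orbit q q' : P q -> P q' -> q.1 = q'.1 ->
  exists h, H h /\ q' = frame_act q h.
Proof.
move=> [_ sq] Pq' qq; have : s q.1 q' by apply/Pbundle_s.
by rewrite -sq => -[h Hh <-]; exists h.
Qed.

Lemma Pbundle_unit c q : P q -> mdom c q.1 -> (q.2 c).1 \in unitmx.
Proof. by move=> [[qi _ _] _] /qi[]. Qed.

(** [christoffel] and [sigma] are choices in sets that must be shown nonempty. Normalising a frame
    of P over p supplies Christoffel symbols; normalising the frame of the chosen symbols supplies
    sigma. *)
Lemma sigma_ex c p : mdom c p ->
  [/\ P (sigma s c p), (sigma s c p).1 = p &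
   (sigma s c p).2 c = mk_jet 1%:M (fun i j k => - thomas s c p i j k)] /\
  normal ((sigma s c p).2 c).
Proof.
move=> cp.
have [q1 Pq1 [q1p q1E]] : exists2 q1, P q1 &
    q1.1 = p /\ q1.2 c = (1%:M, - christoffel s c p).
  suff [q sq qE] : [set Gam | exists2 q, s p q & q.2 c = (1%:M, - Gam)]
      (christoffel s c p) by have [Pq qp] := (Pbundle_s p q).1 sq; exists q.
  have [q [Pq qp]] := Pbundle_over p.
  have cq : mdom c q.1 by rewrite qp.
  have uq := Pbundle_unit Pq cq.
  have [u1 _] := norm_jet_normal uq.
  rewrite /christoffel; set S := [set Gam | _].
  (* A normalised frame has coordinates (x, delta, -Gamma), whence the sign. *)
  apply: (@xgetPex _ 0 S); exists (- (norm_jet (q.2 c)).2).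
  exists (frame_act q (norm_mx (q.2 c))).
    by apply/Pbundle_s; split => //; apply: Pbundle_act => //; exact: norm_mx_group.
  by rewrite opprK -[LHS]/(norm_jet (q.2 c)) [LHS]surjective_pairing u1.
have cq1 : mdom c q1.1 by rewrite q1p.
have uq1 := Pbundle_unit Pq1 cq1.
have nE : norm_jet (q1.2 c) = mk_jet 1%:M (fun i j k => - thomas s c p i j k).
  have [u1 _] := norm_jet_normal uq1.
  apply: jet_ext => [|i j k]; first by rewrite u1.
  rewrite q1E jet2_norm1 //.
  have NE i' j' k' : jet2 (1%:M, - christoffel s c p) i' j' k' =
      - jet2 (1%:M, christoffel s c p) i' j' k' by rewrite /jet2 /= mxE.
  rewrite jet2E /thomas NE; under eq_bigr do rewrite NE.
  under [X in _ - (_ * X * _)]eq_bigr do rewrite NE.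
  by rewrite !sumrN; ring.
have Hn := norm_mx_group uq1.
pose q2 := frame_act q1 (norm_mx (q1.2 c)).
have Pq2 : P q2 by exact: Pbundle_act.
have q2E : q2.2 c = mk_jet 1%:M (fun i j k => - thomas s c p i j k) by [].
(* The set defining [sigma] does not mention P; it contains q2, which lies in P, and nothing else
   because one reading determines a frame. *)
suff -> : sigma s c p = q2 by rewrite q2E -nE; split => //; exact: norm_jet_normal.
rewrite /sigma; set S := [set q | _].
have [P3 q3p q3E] : S (xget ((p, fun=> (0, 0)) : frames M) S).
  by apply: (@xgetPex _ _ S); exists q2; split => //; case: Pq2.
apply: (@P2_eq c) => //; first by case: Pq2.
- by rewrite q3p.
- by rewrite q3p.
by rewrite q3E q2E.
Qed.

Lemma sigma_P c p : mdom c p -> P (sigma s c p).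
Proof. by move=> /sigma_ex[[]]. Qed.

Lemma sigma_base c p : mdom c p -> (sigma s c p).1 = p.
Proof. by move=> /sigma_ex[[]]. Qed.

Lemma sigma_thomas c p : mdom c p ->
  (sigma s c p).2 c = mk_jet 1%:M (fun i j k => - thomas s c p i j k).
Proof. by move=> /sigma_ex[[]]. Qed.

(** All frames of P over a point have the same normal form, so sigma can be computed from whichever
    frame is at hand. *)
Lemma sigma_jet c q : P q -> mdom c q.1 ->
  (sigma s c q.1).2 c = norm_jet (q.2 c).
Proof.
move=> Pq cq; have [[Ps sq _] ns] := sigma_ex cq.
have [h [Hh qE]] := Pbundle_orbit Ps Pq sq.
have uE : q.2 c = jet_mul ((sigma s c q.1).2 c) (H_jet h) by rewrite {1}qE.
exact/esym/(norm_jet_uniq ns Hh uE).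
Qed.

Lemma sigma_act c q : P q -> mdom c q.1 ->
  sigma s c q.1 = frame_act q (norm_mx (q.2 c)).
Proof.
move=> Pq cq; have Hn := norm_mx_group (Pbundle_unit Pq cq).
have [P1 _] := sigma_P cq; have [P3 _] := Pbundle_act Pq Hn.
apply: (@P2_eq c) => //; rewrite ?sigma_base //.
by rewrite sigma_jet.
Qed.

Lemma act_sigma c q : P q -> mdom c q.1 ->
  q = frame_act (sigma s c q.1) (eta_mx (q.2 c)).
Proof.
move=> Pq cq; rewrite sigma_act // frame_actK //.
exact: norm_mx_group (Pbundle_unit Pq cq).
Qed.

Lemma Qbundle_P q : Q q <-> [/\ P q, bd q.1 &
  forall c, mdom c q.1 -> row_stable ord0 (q.2 c).1].
Proof.
split=> [[c [p [h [_ cp bp Hh ->]]]]|[Pq bq rq]].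
  have Ps := sigma_P cp; have sp := sigma_base cp.
  have Pq := Pbundle_act Ps (Ht_sub_H Hh).
  have bq : bd (frame_act (sigma s c p) h).1 by rewrite /= sp.
  split => // c' cq'; have [[_ _ qt] _] := Pq.
  have cq : mdom c (frame_act (sigma s c p) h).1 by rewrite /= sp.
  rewrite (qt c c') // /jet_mul /=; apply: row_stableM.
    by have [] := transition_flat cq cq' bq.
  rewrite sigma_thomas // /= mul1mx.
  by have [] := Ht_jet_flat Hh.
(* Any chart at the point serves: the row condition puts the fibre coordinate in H~. *)
have [c cq] := mchart_cover q.1.
exists c, q.1, (eta_mx (q.2 c)); split => //; first exact: all_boundary_chart.
  by apply: eta_mx_Ht; [exact: Pbundle_unit|exact: rq].
exact: act_sigma.
Qed.

Lemma Q_sub_P : Q `<=` P.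
Proof. by move=> q /Qbundle_P[]. Qed.

Lemma eta_Ht c q : Q q -> mdom c q.1 -> Ht (eta_mx (q.2 c)).
Proof.
move=> /Qbundle_P[Pq _ rq] cq.
by apply: eta_mx_Ht; [exact: Pbundle_unit|exact: rq].
Qed.

Lemma Qbundle_act q h : Q q -> Ht h -> Q (frame_act q h).
Proof.
move=> /Qbundle_P[Pq bq rq] Hh; apply/Qbundle_P; split => //.
  by apply: Pbundle_act => //; exact: Ht_sub_H.
move=> c cq; apply: row_stableM; first exact: rq.
by have [] := Ht_jet_flat Hh.
Qed.

Lemma sigma_Q c p : mdom c p -> bd p -> Q (sigma s c p).
Proof.
move=> cp bp; exists c, p, 1%:M; split => //; first exact: all_boundary_chart.
  apply/Ht_groupP; split; first exact: unitmx1.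
    exact: row_stable_scalar.
  exact: col_stable_scalar.
by rewrite frame_act_scalar ?oner_neq0.
Qed.

Lemma Pi0_flat c p : mdom c p ->
  Pi0_in_span_dr s c p <-> flat ((sigma s c p).2 c).
Proof.
move=> cp; rewrite sigma_thomas //; split => [pi|[_ f2] mu].
  split=> [|j k]; first exact: row_stable_scalar.
  case: (unliftP ord0 j) => [mu ->|-> //]; have [lambda piE] := pi mu.
  by move=> _ /negPf k0; rewrite jet2E piE k0 mulr0 oppr0.
(* The multiple of dr can only be the coefficient Pi^0_{mu 0}. *)
exists (thomas s c p ord0 (lift ord0 mu) ord0) => k.
have [->|k0] := eqVneq k ord0; first by rewrite mulr1.
have := f2 (lift ord0 mu) k erefl k0; rewrite jet2E mulr0.
by move/eqP; rewrite oppr_eq0 => /eqP.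
Qed.

(** Read in c', the frame sigma of c stays flat; renormalising it there acts by an element of H~,
    which preserves flatness and yields sigma of c'. *)
Lemma Pi0_all c c' p : mdom c p -> mdom c' p -> bd p ->
  Pi0_in_span_dr s c p -> Pi0_in_span_dr s c' p.
Proof.
move=> cp cp' bp /(Pi0_flat cp) fl; apply/(Pi0_flat cp').
have Ps := sigma_P cp; have sp := sigma_base cp.
have cs : mdom c (sigma s c p).1 by rewrite sp.
have cs' : mdom c' (sigma s c p).1 by rewrite sp.
have fl' : flat ((sigma s c p).2 c').
  have [[_ _ qt] _] := Ps; rewrite (qt c c') //.
  by apply: flat_mul => //; apply: transition_flat => //; rewrite sp.
have := sigma_jet Ps cs'; rewrite sp => ->.
apply: flat_mul => //; apply: Ht_jet_flat; apply: norm_mx_Ht.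
  exact: Pbundle_unit.
by case: fl'.
Qed.

(** A smooth lift f of s comes with its own charts c1 and d1; once reread in c, its normal form is
    the reading of sigma. *)
Lemma sigma_smooth c p : mdom c p -> exists S : 'rV[R]_n -> jet R m,
  [/\ smoothat (mcoord c p) S, S (mcoord c p) = (sigma s c p).2 c &
   \forall x \near mcoord c p, forall q : M, mdom c q -> mcoord c q = x ->
     (sigma s c q).2 c = S x].
Proof.
move=> cp; have [W [f [[cW [OW [cWp oOW OWp WE]]] fW sf]]] := hs.2 p.
have Wp : W p by rewrite WE.
have oW : open W by rewrite WE; exact: chart_preimage_open.
have [c1 [d1 [c1p d1p [ O1 [g [oO1 O1p sg gE]]]]]] := sf p Wp.
have fE (q : M) : W q -> [/\ P (f q), (f q).1 = q & P2 (f q)].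
  by move=> Wq; have [Pf fq sq] := fW q Wq; split => //; split => //; rewrite -sq fq.
have [Pfp fp _] := fE p Wp.
rewrite /= fp in d1p.
have [tau [stau tauE]] := chart_transition cp c1p.
have taup : mcoord c1 p = tau (mcoord c p) by have [] := nbhs_singleton tauE p cp erefl.
have [J [sJ JE]] := transition_smooth d1p cp.
have gp : g (mcoord c1 p) = (mcoord d1 p, (f p).2 d1).
  by have [_ <-] := gE p Wp c1p O1p; rewrite /= fp.
pose G x := g (tau x).
have Gp : G (mcoord c p) = (mcoord d1 p, (f p).2 d1) by rewrite /G -taup.
have sG : smoothat (mcoord c p) G.
  apply: smoothat_comp stau _; first exact: findim_mx.
    by apply: findim_prod; [exact: findim_mx|exact: findim_jet].
  by rewrite -taup; exact: smooth_smoothat sg.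
have sG1 : smoothat (mcoord c p) (fun x => (G x).1) by exact: smoothat_fst.
have sJG : smoothat (mcoord c p) (fun x => J (G x).1).
  apply: smoothat_comp sG1 _; [exact: findim_mx|exact: findim_jet|].
  by rewrite Gp.
(* The reading of f in c: [(G x).1] is the base point in d1, where the transition jet J to c is
   evaluated. *)
pose F x := jet_mul (J (G x).1) (G x).2.
have sF : smoothat (mcoord c p) F.
  by apply: smoothat_jet_mul => //; exact: smoothat_snd.
have near_tau : \forall x \near mcoord c p, O1 (tau x).
  have ct := smoothat_continuous stau; rewrite -taup in ct.
  exact: (ct _ (open_nbhs_nbhs (conj oO1 O1p))).
have near_J : \forall x \near mcoord c p, forall q : M, mdom d1 q ->
    mcoord d1 q = (G x).1 -> transition_jet d1 c q = J (G x).1.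
  have cG := smoothat_continuous sG1; rewrite Gp in cG.
  exact: (cG _ JE).
have FE : \forall x \near mcoord c p, forall q : M, mdom c q -> mcoord c q = x ->
    W q /\ (f q).2 c = F x.
  apply: filterS (filterI (filterI near_tau near_J)
    (filterI tauE (near_chart_dom oW Wp cp))) => x [ [tx1 Jx] [tx Wx]] q cq qx.
  have Wq := Wx q cq qx; split => //; have [c1q c1x] := tx q cq qx.
  have [_ fq P2f] := fE q Wq.
  have [] := gE q Wq c1q; first by rewrite /= c1x.
  rewrite /= fq c1x -[g _]/(G x) => d1q Gx.
  have [_ _ qt] := P2f; rewrite (qt d1 c) ?fq //.
  by rewrite /F -Gx /= (Jx q d1q) // -Gx.
have Fp : (f p).2 c = F (mcoord c p) by have [] := nbhs_singleton FE p cp erefl.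
have up : (F (mcoord c p)).1 \in unitmx.
  by rewrite -Fp; apply: Pbundle_unit => //; rewrite fp.
have sE : \forall x \near mcoord c p, forall q : M, mdom c q -> mcoord c q = x ->
     (sigma s c q).2 c = norm_jet (F x).
  apply: filterS FE => x Fx q cq qx; have [Wq <-] := Fx q cq qx.
  by have [Pf fq _] := fE q Wq; rewrite -sigma_jet ?fq.
exists (fun x => norm_jet (F x)); split => //; first exact: smoothat_norm_jet.
by rewrite (nbhs_singleton sE p cp erefl).
Qed.

End Frames.

(** * Smooth maps, velocities and tangent spaces of charted sets *)

Section Charted.
Variable R : realType.
Implicit Types X Y : charted R.

Lemma smooth_at_intro X Y (A : set X) (f : X -> Y) p (c : chart X) (d : chart Y)
    (g : model X -> model Y) : dom c p -> dom d (f p) -> smoothat (coord c p) g ->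
  (\forall x \near coord c p, forall q, A q -> dom c q -> coord c q = x ->
    dom d (f q) /\ coord d (f q) = g x) -> smooth_at A f p.
Proof.
move=> cp dp [ O [oO Ox sg]] fg; exists c, d; split => //.
pose S := [set x | forall q, A q -> dom c q -> coord c q = x ->
  dom d (f q) /\ coord d (f q) = g x].
exists (O `&` interior S), g; split.
- by apply: openI => //; exact: open_interior.
- by split.
- by move=> k; apply: Ck_sub (sg k) => x [].
- by move=> q Aq cq [_ /interior_subset Sq]; apply: Sq.
Qed.

Lemma velocity_sub X (A B : set X) gam p c v : A `<=` B ->
  velocity A gam p c v -> velocity B gam p c v.
Proof.
move=> AB [g0 dp [ e [g [e0 sg gE vE]]]]; split => //; exists e, g; split => //.
by move=> t t0 te; have [At dt ct] := gE t t0 te; split => //; exact: AB.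
Qed.

Lemma velocity_tangent X (A : set X) gam p c v :
  velocity A gam p c v -> tangent A p c v.
Proof.
move=> vv; exists 1%N, (fun=> 1), (fun=> v); split; first by move=> _; exists gam.
by rewrite big_ord1 scale1r.
Qed.

Lemma velocityD_tangent X (A : set X) gam gam' p c v w :
  velocity A gam p c v -> velocity A gam' p c w -> tangent A p c (v + w).
Proof.
move=> vv vw; exists 2%N, (fun=> 1), (fun i => if i == ord0 then v else w).
split; last by rewrite big_ord_recl big_ord1 !scale1r.
by move=> i; case: ifP => _; [exists gam|exists gam'].
Qed.

Lemma tangent_sub X (A B : set X) p c : A `<=` B -> tangent A p c `<=` tangent B p c.
Proof.
move=> AB v [k [a [w [vw ->]]]]; exists k, a, w; split => // i.
by have [gam vi] := vw i; exists gam; exact: velocity_sub vi.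
Qed.

Lemma tangent0 X (A : set X) p c : tangent A p c 0.
Proof. by exists 0%N, (fun=> 0), (fun=> 0); split => [[]|]; rewrite ?big_ord0. Qed.

End Charted.

(** * Lie algebras *)

Section LieAlgebras.
Variables (R : realType) (N : nat).
Local Notation MN := 'M[R]_N.
Local Notation XN := (vect_charted MN).

Lemma velocity_row_stable i (G : set MN) gam (v : MN) :
  (forall g, G g -> row_stable i g) ->
  @velocity R XN G gam 1%:M tt v -> row_stable i v.
Proof.
move=> GP /velocityP[_ _ [g [sg gE ->]]] j ji.
have dg := smoothat_differentiable sg.
rewrite -(derive1_clin (clin_coord i j)) //.
have dgij : differentiable (fun t : R => g t i j) (0 : R).
  by apply: smoothat_differentiable; exact: smoothat_coord.
rewrite (derive1_right_eq (g := fun=> 0) dgij) ?derive1_cst //.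
apply: filterS gE => t Ht t0; have [Gt _ /= <-] := Ht t0.
exact: GP.
Qed.

Lemma row_stable_mod_scalars i (X : MN) : row_stable i X -> row_stable i (mod_scalars X).
Proof.
move=> rX; rewrite /mod_scalars -scaleN1r; apply: row_stableD => //.
by apply: row_stableZ; exact: row_stable_scalar.
Qed.

Lemma mod_scalars_tr0 (X : MN) : \tr X = 0 -> mod_scalars X = X.
Proof. by move=> X0; rewrite /mod_scalars X0 mul0r raddf0 subr0. Qed.

Lemma tr_mod_scalars (X : MN) : (0 < N)%N -> \tr (mod_scalars X) = 0.
Proof.
move=> N0; rewrite /mod_scalars linearB /= mxtrace_scalar.
rewrite -[X in _ - X]mulr_natr divfK ?subrr //.
by rewrite pnatr_eq0 -lt0n.
Qed.

Lemma velocity_line (G : set MN) (A : MN) :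
  (\forall t \near (0 : R), G (1%:M + t *: A)) ->
  @velocity R XN G (fun t : R => 1%:M + t *: A) 1%:M tt A.
Proof.
move=> GA; apply/velocityP; split => //; first by rewrite scale0r addr0.
exists (fun t : R => 1%:M + t *: A); split; first exact: smoothat_line.
  by apply: filterS GA.
by rewrite derive1_line_id.
Qed.

Lemma near_unit_line (A : MN) : \forall t \near (0 : R), 1%:M + t *: A \in unitmx.
Proof.
apply: near_unitmx; first by rewrite scale0r addr0 unitmx1.
exact: smoothat_line.
Qed.

End LieAlgebras.

Section LieGt.
Variables (R : realType) (m : nat).
Local Notation MN := 'M[R]_(m.+1 + 1).

Lemma lie_algebra_tr (G : set MN) X : lie_algebra G X -> \tr X = 0.
Proof. by move=> [Y _ <-]; apply: tr_mod_scalars; rewrite addn1. Qed.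

(** G~ is the invertible part of a linear space of matrices containing the scalars. For X in that
    space, 1 + t X stays in G~ for small t. *)
Lemma lie_algebra_Gt (X : MN) : lie_algebra (Gt_group R m) X <->
  \tr X = 0 /\ row_stable (i0 m) X.
Proof.
split=> [LX|[tX rX]].
  split; first exact: lie_algebra_tr LX.
  have [Y [k [a [w [vw ->]]]] <-] := LX; apply: row_stable_mod_scalars.
  elim/big_ind : _ => [||i _]; first by move=> j ji; rewrite mxE.
    exact: row_stableD.
  apply: row_stableZ; have [gam] := vw i; apply: velocity_row_stable.
  by move=> g /Gt_groupP[].
exists X; last exact: mod_scalars_tr0.
apply: (@velocity_tangent R (vect_charted MN)); apply: velocity_line.
apply: filterS (near_unit_line X) => t ut; apply/Gt_groupP; split => //.
by apply: row_stableD; [exact: row_stable_scalar|exact: row_stableZ].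
Qed.

End LieGt.

(** * The induced Cartan geometry *)

Section BoundaryCartan.
Variables (R : realType) (m : nat) (M : bmanifold R m).
Variable s : M -> set (frames M).
Hypothesis hs : projective_structure s.
Local Notation n := m.+1.
Local Notation MN := 'M[R]_(n + 1).
Local Notation XN := (vect_charted MN).
Local Notation H := (H_group R m).
Local Notation Ht := (Ht_group R m).
Local Notation P := (Pbundle s).
Local Notation Q := (Qbundle s).
Implicit Types (c : mchart M) (p : M) (q : frames M) (h : MN).

Lemma smoothat_H_jet_id h : H h -> smoothat h (fun k : MN => H_jet k).
Proof. by move=> Hh; apply: smoothat_H_jet => //; exact: smoothat_id. Qed.

(** Each sigma trivialises Q over the boundary points of its whole chart domain, with fibre
    coordinate [eta_mx]. Freeness modulo Z is cancellation of jets followed by [H_jet_inj]. *)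
Lemma bd_principal_bundle : principal_bundle (@frame_base R m M)
  (@frame_act R m M) (@bd R m M) Q Ht.
Proof.
split.
- by move=> q /(Qbundle_P hs)[].
- by move=> q h Qq Hh; split => //; exact: Qbundle_act.
- by move=> q a _ a0; exact: frame_act_scalar.
- by move=> q h k _ Hh Hk; rewrite frame_actM //; exact: Ht_sub_H.
split.
  move=> q Qq; have [c cq] := mchart_cover q.1.
  apply: (@smooth_at_intro R (frames M) (bcharted M) _ _ _ c c fst) => //.
    by apply: smoothat_clin; exact: clin_fst.
  by apply: filterE => x q' _ cq' <-.
move=> x bx; have [c cx] := mchart_cover x.
exists (mdom c), (sigma s c); split.
- exists c, setT; split => //; first exact: openT.
  by apply/seteqP; split => y /=; tauto.
- by move=> y cy bdy; split; [exact: sigma_Q|exact: sigma_base].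
- move=> [y h] [/= cy bdy Hh].
  have [S [sS Sy SE]] := sigma_smooth hs cy.
  pose g (xh : 'rV[R]_n * MN) := (xh.1, jet_mul (S xh.1) (H_jet xh.2)).
  apply: (@smooth_at_intro R (prod_charted (bcharted M) XN) (frames M) _ _ _
    (c, tt) c g) => //=.
  + by rewrite sigma_base.
  + have s1 : smoothat (mcoord c y, h) (@fst 'rV[R]_n MN).
      by apply: smoothat_clin; exact: clin_fst.
    have s2 : smoothat (mcoord c y, h) (@snd 'rV[R]_n MN).
      by apply: smoothat_clin; exact: clin_snd.
    apply: smoothat_pair => //; apply: smoothat_jet_mul.
      by apply: smoothat_comp s1 _; [exact: findim_mx|exact: findim_jet|].
    apply: smoothat_comp s2 _; [exact: findim_mx|exact: findim_jet|].
    by apply: smoothat_H_jet_id; exact: Ht_sub_H.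
  + have c1 : (@fst 'rV[R]_n MN) @ (mcoord c y, h) --> mcoord c y by exact: cvg_fst.
    have SE' : \forall xk \near (mcoord c y, h), forall q : M, mdom c q ->
      mcoord c q = xk.1 -> (sigma s c q).2 c = S xk.1 by exact: (c1 _ SE).
    apply: filterS SE' => -[x1 k] /= Hx [q k'] /= [cq _ _] [cq' _] [qx <-].
    rewrite sigma_base //; split => //.
    by rewrite /g /= (Hx q cq qx) qx.
- move=> y h k cy bdy Hh Hk E.
  apply: H_jet_inj; [exact: Ht_sub_H|exact: Ht_sub_H|].
  have := congr1 (fun q : frames M => q.2 c) E; rewrite /= sigma_thomas //.
  set a := mk_jet _ _; have a1 : a.1 \in unitmx by rewrite /= unitmx1.
  by move/(jet_mulI a1).
- move=> q0 Qq0 cq0; exists (fun q => eta_mx (q.2 c)); split.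
    have Pq0 := Q_sub_P hs Qq0.
    have s2 : smoothat (mcoord c q0.1, q0.2 c) (@snd 'rV[R]_n (jet R m)).
      by apply: smoothat_clin; exact: clin_snd.
    apply: (@smooth_at_intro R (frames M) XN _ _ _ c tt (fun xu => eta_mx xu.2)) => //.
      by apply: smoothat_eta_mx => //=; exact: Pbundle_unit Pq0 cq0.
    by apply: filterE => -[x1 u] q _ cq [_ <-].
  move=> q Qq cq; split; first exact: (eta_Ht hs Qq cq).
  exact: (act_sigma hs (Q_sub_P hs Qq) cq).
Qed.
End BoundaryCartan.

(** * Values of the connection form on vectors tangent to Q *)

Section Connection.
Variables (R : realType) (m : nat) (M : bmanifold R m).
Variable s : M -> set (frames M).
Hypothesis hs : projective_structure s.
Local Notation n := m.+1.
Local Notation MN := 'M[R]_(n + 1).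
Local Notation XN := (vect_charted MN).
Local Notation H := (H_group R m).
Local Notation Ht := (Ht_group R m).
Local Notation P := (Pbundle s).
Local Notation Q := (Qbundle s).
Implicit Types (c : mchart M) (p : M) (q : frames M) (h : MN).
Variable om : frames M -> chart (frames M) -> model (frames M) -> MN.
Hypothesis hom : normal_cartan_connection s om.

Lemma frames_velocity (A : set (frames M)) (gam : R -> frames M) q c
    (x : R -> 'rV[R]_n) (u : R -> jet R m) : gam 0 = q -> mdom c q.1 ->
  smoothat (0 : R) x -> smoothat (0 : R) u ->
  (\forall t \near (0 : R), 0 <= t -> [/\ A (gam t), mdom c (gam t).1,
     mcoord c (gam t).1 = x t & (gam t).2 c = u t]) ->
  velocity A gam q c (derive1 x 0, derive1 u 0).
Proof.
move=> g0 cq sx su xuE; apply/velocityP; split => //.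
exists (fun t => (x t, u t)); split; first exact: smoothat_pair.
  by apply: filterS xuE => t Ht t0; have [At ct <- <-] := Ht t0.
rewrite derive1_pair //.
  exact: smoothat_differentiable sx.
exact: smoothat_differentiable su.
Qed.

(** Separates the motion of the section, fibre element frozen, from the motion in the fibre. *)
Lemma derive1_jet_mul (S L : R -> jet R m) :
  smoothat (0 : R) S -> smoothat (0 : R) L ->
  derive1 (fun t => jet_mul (S t) (L t)) 0 =
  derive1 (fun t => jet_mul (S t) (L 0)) 0 + derive1 (fun t => jet_mul (S 0) (L t)) 0.
Proof.
move=> sS sL; pose F (ab : R * R) := jet_mul (S ab.1) (L ab.2).
have dF : differentiable F (0, 0).
  have s1 : smoothat (0 : R, 0 : R) (@fst R R) by apply: smoothat_clin; exact: clin_fst.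
  have s2 : smoothat (0 : R, 0 : R) (@snd R R) by apply: smoothat_clin; exact: clin_snd.
  apply: smoothat_differentiable; apply: smoothat_jet_mul.
    by apply: smoothat_comp s1 _; [exact: findim_scalar|exact: findim_jet|].
  by apply: smoothat_comp s2 _; [exact: findim_scalar|exact: findim_jet|].
exact: (derive1_diag dF).
Qed.

(** The gauge formula gives [om] along sigma only; right translation by the constant h brings in
    Ad(h^-1). *)
Lemma om_sigma_curve c p h (gam : R -> M) (x : R -> 'rV[R]_n) (S : R -> jet R m) :
  gam 0 = p -> mdom c p -> H h -> smoothat (0 : R) x -> smoothat (0 : R) S ->
  (\forall t \near (0 : R), 0 <= t -> [/\ mdom c (gam t),
     mcoord c (gam t) = x t & (sigma s c (gam t)).2 c = S t]) ->
  forall w, w = (derive1 x 0, derive1 (fun t => jet_mul (S t) (H_jet h)) 0) ->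
  velocity P (fun t => frame_act (sigma s c (gam t)) h)
    (frame_act (sigma s c p) h) c w /\
  om (frame_act (sigma s c p) h) c w =
    invmx h *m mod_scalars (normal_gauge s c p (derive1 x 0)) *m h.
Proof.
move=> g0 cp Hh sx sS xS w wE; have [[_ _ _ [eqv _ _]] gauge] := hom.
have vx : @velocity R (bcharted M) setT gam p c (derive1 x 0).
  apply/velocityP; split => //; exists x; split => //.
  by apply: filterS xS => t Ht t0; have [] := Ht t0.
have vs : velocity P (fun t => sigma s c (gam t)) (sigma s c p) c
    (derive1 x 0, derive1 S 0).
  apply: frames_velocity; [by rewrite g0|by rewrite sigma_base|exact: sx|exact: sS|].
  apply: filterS xS => t Ht t0; have [ct xt St] := Ht t0.
  by rewrite sigma_base //; split => //; exact: sigma_P.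
have vw : velocity P (fun t => frame_act (sigma s c (gam t)) h)
    (frame_act (sigma s c p) h) c w.
  rewrite wE; apply: frames_velocity.
  - by rewrite g0.
  - by rewrite /= sigma_base.
  - exact: sx.
  - by apply: smoothat_jet_mul; [exact: sS|exact: smoothat_cst].
  apply: filterS xS => t Ht t0; have [ct xt St] := Ht t0.
  rewrite /= sigma_base // St; split => //.
  by apply: Pbundle_act => //; exact: sigma_P.
split => //; rewrite -(gauge c p gam _ _ vx vs).
by apply: eqv vs vw => //; exact: sigma_P.
Qed.

Lemma om_vertical_curve q c (k : R -> MN) : P q -> mdom c q.1 ->
  smoothat (0 : R) k -> k 0 = 1%:M ->
  (\forall t \near (0 : R), 0 <= t -> H (k t)) ->
  forall w, w = (0 : 'rV[R]_n, derive1 (fun t => jet_mul (q.2 c) (H_jet (k t))) 0) ->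
  velocity P (fun t => frame_act q (k t)) q c w /\
  om q c w = mod_scalars (derive1 k 0).
Proof.
move=> Pq cq sk k0 Hk w wE; have [[_ _ _ [_ fund _]] _] := hom.
have vk : @velocity R XN H k 1%:M tt (derive1 k 0).
  apply/velocityP; split => //; exists k; split => //.
  by apply: filterS Hk => t Ht t0; split => //; exact: Ht.
have vw : velocity P (fun t => frame_act q (k t)) q c w.
  rewrite wE -(derive1_cst (mcoord c q.1) (0 : R)).
  apply: frames_velocity => //.
  - by rewrite k0 frame_act_scalar ?oner_neq0.
  - exact: smoothat_cst.
  - apply: smoothat_jet_mul; first exact: smoothat_cst.
    by apply: smoothat_H_jet => //; rewrite k0; exact: H_group1.
  - apply: filterS Hk => t Ht t0; split => //.
    by apply: Pbundle_act => //; exact: Ht.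
by split => //; exact: fund vk vw.
Qed.

(** Here the hypothesis on Pi acts: a multiple of dr is evaluated on a vector with dr(v) = 0. *)
Lemma row_stable_gauge c p (v : 'rV[R]_n) : Pi0_in_span_dr s c p ->
  v 0 ord0 = 0 -> row_stable (i0 m) (normal_gauge s c p v).
Proof.
move=> pi v0 j; rewrite /i0; case: (split_ordP j) => k ->.
  rewrite (inj_eq (@lshift_inj _ _)) block_mxEul mxE.
  case: (unliftP ord0 k) => [mu ->|-> //] _; have [lambda piE] := pi mu.
  apply: big1 => l _; rewrite piE; have [->|_] := eqVneq l ord0.
    by rewrite v0 mulr0.
  by rewrite mulr0 mul0r.
by rewrite block_mxEur mxE (ord1 k) v0.
Qed.

Hypothesis hPi : forall c p, mdom c p -> bd p -> Pi0_in_span_dr s c p.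

Lemma om_velocity_row_stable q c gam v : Q q -> velocity Q gam q c v ->
  row_stable (i0 m) (om q c v).
Proof.
move=> Qq /velocityP[g0 cq [g [sg gE ->]]].
have Pq := Q_sub_P hs Qq; have [_ bq _] := (Qbundle_P hs q).1 Qq.
have [[_ _ [_ om_lin _] _] _] := hom.
have g00 : g 0 = (mcoord c q.1, q.2 c).
  by have [//|_ _ <-] := nbhs_singleton gE; rewrite g0.
pose x t := (g t).1; pose u t := (g t).2.
have sx : smoothat (0 : R) x by exact: smoothat_fst.
have su : smoothat (0 : R) u by exact: smoothat_snd.
have u0 : u 0 = q.2 c by rewrite /u g00.
have uu : (u 0).1 \in unitmx by rewrite u0; exact: Pbundle_unit Pq cq.
(* The decomposition u = S . h is computed from the smooth representative u, hence smooth on both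
   sides of 0, while S reads sigma for t >= 0. *)
pose S t := norm_jet (u t); pose h t := eta_mx (u t).
have sS : smoothat (0 : R) S by exact: smoothat_norm_jet.
have sh : smoothat (0 : R) h by exact: smoothat_eta_mx.
have Hh0 : Ht (h 0) by rewrite /h u0; exact: (eta_Ht hs Qq cq).
have uh0 := H_group_unit (Ht_sub_H Hh0).
have qE : q = frame_act (sigma s c q.1) (h 0) by rewrite /h u0; exact: act_sigma.
have S0 : S 0 = (sigma s c q.1).2 c by rewrite /S u0 sigma_jet.
have [w3 w3E] : exists w : model (frames M),
    w = (derive1 x 0, derive1 (fun t => jet_mul (S t) (H_jet (h 0))) 0).
  exact: (ex_intro _ _ erefl).
have [|vw3 omw3] := @om_sigma_curve c q.1 (h 0) (fun t => (gam t).1) x S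
  (congr1 fst g0) cq (Ht_sub_H Hh0) sx sS _ w3 w3E.
  apply: filterS gE => t Ht' t0; have [Qt ct gt] := Ht' t0.
  by rewrite /S /u /x -gt /=; split => //; apply: sigma_jet => //; exact: Q_sub_P.
rewrite -qE in vw3 omw3.
have Hth : \forall t \near (0 : R), 0 <= t -> Ht (h t).
  apply: filterS gE => t Ht' t0; have [Qt ct gt] := Ht' t0.
  by rewrite /h /u -gt /=; exact: (eta_Ht hs Qt ct).
have uSh : \forall t \near (0 : R), u t = jet_mul (S t) (H_jet (h t)).
  have ut : \forall t \near (0 : R), (u t).1 \in unitmx.
    by apply: (@near_unitmx R R n (fun t => (u t).1)) => //; exact: smoothat_fst su.
  by apply: filterS ut => t ut; rewrite norm_eta.
have dgE : derive1 g 0 = (derive1 x 0, derive1 u 0).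
  have dg := smoothat_differentiable sg.
  rewrite [LHS]surjective_pairing; congr pair; apply/esym.
    exact: (derive1_clin (@clin_fst _ _ _) dg).
  exact: (derive1_clin (@clin_snd _ _ _) dg).
(* The base curve lies in the boundary, so x^0 vanishes for t >= 0. *)
have dx0 : derive1 x 0 0 ord0 = 0.
  rewrite -(derive1_clin (clin_coord 0 ord0)); last exact: smoothat_differentiable sx.
  have dx0 : differentiable (fun t : R => x t 0 ord0) (0 : R).
    by apply: (@smoothat_differentiable R R); exact: smoothat_coord.
  rewrite (derive1_right_eq (g := fun=> 0) dx0) ?derive1_cst //.
  apply: filterS gE => t Ht' t0; have [Qt ct gt] := Ht' t0.
  by rewrite /x -gt /=; apply/(bd_coord ct); case/(Qbundle_P hs): Qt.
clearbody S h x u.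
have sHh : smoothat (0 : R) (fun t => H_jet (h t)).
  by apply: smoothat_H_jet; [exact: Ht_sub_H|].
(* Left translation makes the fibre curve start at 1: q . k(t) is sigma(x(0)) . h(t), so the
   fundamental-field axiom applies at q. *)
have [k kE] : exists k : R -> MN, forall t, k t = invmx (h 0) *m h t by eexists.
have sk : smoothat (0 : R) k.
  apply: (smoothat_ext (fun t => esym (kE t))); apply: smoothat_mulmx sh.
  exact: smoothat_cst.
have Hk : \forall t \near (0 : R), 0 <= t -> Ht (k t).
  have [_ _ HtM HtV _] := Ht_matrix_subgroup R m.
  apply: filterS Hth => t Hht t0; rewrite kE.
  by apply: HtM; [exact: HtV|exact: Hht].
have k0 : k 0 = 1%:M by rewrite kE mulVmx.
have sHk : smoothat (0 : R) (fun t => H_jet (k t)).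
  by apply: smoothat_H_jet; [rewrite k0; exact: H_group1|].
have [w4 w4E] : exists w : model (frames M),
    w = (0, derive1 (fun t => jet_mul (q.2 c) (H_jet (k t))) 0).
  exact: (ex_intro _ _ erefl).
have [|vw4 omw4] := om_vertical_curve Pq cq sk k0 _ w4E.
  by apply: filterS Hk => t Ht' t0; apply/Ht_sub_H/Ht'.
have dhk : derive1 (fun t => jet_mul (S 0) (H_jet (h t))) 0 =
           derive1 (fun t => jet_mul (q.2 c) (H_jet (k t))) 0.
  apply: derive1_right_eq.
  - apply: smoothat_differentiable; apply: smoothat_jet_mul sHh.
    exact: smoothat_cst.
  - apply: smoothat_differentiable; apply: smoothat_jet_mul sHk.
    exact: smoothat_cst.
  apply: filterS Hk => t Ht' t0; have Hkt := Ht_sub_H (Ht' t0).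
  rewrite -u0 (nbhs_singleton uSh) -jet_mulA -H_jetM //; last exact: Ht_sub_H.
  by rewrite kE mulKVmx.
have du : derive1 u 0 = derive1 (fun t => jet_mul (S t) (H_jet (h t))) 0.
  apply: derive1_right_eq.
  - exact: smoothat_differentiable su.
  - by apply: smoothat_differentiable; exact: smoothat_jet_mul.
  - by apply: filterS uSh.
(* Both summands are velocities of curves in P, as linearity of [om] requires; the base component of
   w4 is 0. *)
have gE' : derive1 g 0 = 1 *: w3 + w4.
  rewrite dgE (etrans du (derive1_jet_mul sS sHh)) dhk scale1r w3E w4E.
  by congr pair; rewrite /= addr0.
have omE := om_lin q c Pq cq 1 _ _ (velocity_tangent vw3) (velocity_tangent vw4).
rewrite gE' omE scale1r omw3 omw4; apply: row_stableD.
  have [_ rh _] := (Ht_groupP (h 0)).1 Hh0.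
  have rG := row_stable_mod_scalars (row_stable_gauge (hPi cq bq) dx0).
  exact: (row_stableM (row_stableM (row_stableV uh0 rh) rG) rh).
apply: row_stable_mod_scalars.
apply: (@velocity_row_stable R _ (i0 m) Ht k); first by move=> h' /Ht_groupP[].
apply/velocityP; split; [exact: k0|exact: I|].
exists k; split; [exact: sk| |exact: erefl].
by apply: filterS Hk => t Ht' t0; split; [exact: Ht'|exact: I|exact: erefl].
Qed.

Lemma om_tangent_row_stable q c v : Q q -> mdom c q.1 -> tangent Q q c v ->
  row_stable (i0 m) (om q c v).
Proof.
move=> Qq cq [k [a [w [vw ->]]]].
have Pq := Q_sub_P hs Qq.
have [[_ _ [_ om_lin _] _] _] := hom.
elim: k a w vw => [|k IH] a w vw.
  (* The empty combination: linearity forces [om] to vanish at 0. *)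
  have := om_lin q c Pq cq 1 0 0 (tangent0 _ _ _) (tangent0 _ _ _).
  rewrite !scale1r addr0 big_ord0 => /eqP; rewrite -subr_eq0 opprD addrA subrr sub0r.
  by rewrite oppr_eq0 => /eqP -> j _; rewrite mxE.
rewrite big_ord_recl om_lin //.
- apply: row_stableD; last by apply: IH => i; exact: vw.
  apply: row_stableZ; have [gam vg] := vw ord0.
  exact: om_velocity_row_stable vg.
- have [gam vg] := vw ord0; apply: velocity_tangent.
  exact: (velocity_sub (Q_sub_P hs) vg).
- exists k, (fun i => a (lift ord0 i)), (fun i => w (lift ord0 i)); split => // i.
  have [gam vg] := vw (lift ord0 i); exists gam.
  exact: (velocity_sub (Q_sub_P hs) vg).
Qed.

Lemma om_tangent_surj q c X : Q q -> mdom c q.1 -> \tr X = 0 ->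
  row_stable (i0 m) X -> exists2 w, tangent Q q c w & om q c w = X.
Proof.
move=> Qq cq tX rX.
have Pq := Q_sub_P hs Qq; have [_ bq _] := (Qbundle_P hs q).1 Qq.
have [[_ _ [_ om_lin _] _] _] := hom.
pose h := eta_mx (q.2 c); have Hh : Ht h := eta_Ht hs Qq cq.
have uh := H_group_unit (Ht_sub_H Hh).
have [_ rh ch] := (Ht_groupP h).1 Hh.
have qE : q = frame_act (sigma s c q.1) h by exact: act_sigma.
(* X is moved to sigma, where the gauge formula holds; H~ preserves the row condition. *)
pose Y := h *m X *m invmx h.
have rY : row_stable (i0 m) Y.
  by apply: row_stableM; [exact: row_stableM|exact: row_stableV].
(* The last column of the gauge matrix is dx^i, so it prescribes the base direction; the row
   condition on Y makes v tangent to the boundary. *)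
pose v : 'rV[R]_n := \row_j Y (lshift 1 j) (iN m).
have v0 : v 0 ord0 = 0 by rewrite mxE; apply: rY; rewrite eq_sym i0N.
have q0 := (bd_coord cq).1 bq.
pose x (t : R) := mcoord c q.1 + t *: v.
have sx : smoothat (0 : R) x by exact: smoothat_line.
have x0 t : x t 0 ord0 = 0 by rewrite mxE [X in _ + X]mxE q0 v0 mulr0 addr0.
pose gam t := chart_inv c q.1 (x t).
have gam0 : gam 0 = q.1 by rewrite /gam /x scale0r addr0 chart_invE.
have gamE : \forall t \near (0 : R), [/\ mdom c (gam t), mcoord c (gam t) = x t &
    bd (gam t)].
  apply: filterS (near_line v (near_chart (@chart_open _ _ _ c) cq cq)) => t Hx.
  have [|p [cp _ px]] := Hx; first by rewrite /half_space /= x0.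
  rewrite /gam -[x t]px chart_invE //; split => //.
  by apply/(bd_coord cp); rewrite px x0.
have [S [sS Sq SE]] := sigma_smooth hs cq.
have sSx : smoothat (0 : R) (fun t => S (x t)).
  apply: smoothat_comp sx _; [exact: findim_mx|exact: findim_jet|].
  by rewrite /x scale0r addr0.
have dx : derive1 x 0 = v by exact: derive1_line_id.
have sE : \forall t \near (0 : R), [/\ mdom c (gam t), bd (gam t),
    mcoord c (gam t) = x t & (sigma s c (gam t)).2 c = S (x t)].
  apply: filterS2 gamE (near_line v SE) => t [ct xt bt] St.
  by split => //; exact: St.
have [w3 w3E] : exists w : model (frames M),
    w = (derive1 x 0, derive1 (fun t => jet_mul (S (x t)) (H_jet h)) 0).
  exact: (ex_intro _ _ erefl).
have [|_ omw3] := @om_sigma_curve c q.1 h gam x (fun t => S (x t)) gam0 cq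
  (Ht_sub_H Hh) sx sSx _ w3 w3E.
  by apply: filterS sE => t [].
have vw3 : velocity Q (fun t => frame_act (sigma s c (gam t)) h) q c w3.
  rewrite w3E; apply: frames_velocity; [by rewrite gam0|exact: cq|exact: sx| |].
    by apply: smoothat_jet_mul; [exact: sSx|exact: smoothat_cst].
  apply: filterS sE => t [ct bt xt St] _; rewrite /= sigma_base // St; split => //.
  by apply: Qbundle_act => //; exact: sigma_Q.
rewrite -qE dx in omw3; set G := mod_scalars _ in omw3.
have rG : row_stable (i0 m) G.
  by apply: row_stable_mod_scalars; apply: row_stable_gauge => //; exact: hPi.
pose A := invmx h *m (Y - G) *m h.
have rYG : row_stable (i0 m) (Y - G).
  by rewrite -scaleN1r; apply: row_stableD => //; exact: row_stableZ.
have rA : row_stable (i0 m) A.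
  by apply: row_stableM => //; apply: row_stableM => //; exact: row_stableV.
(* By the choice of v, Y and G agree off the diagonal in their last column; [mod_scalars] alters the
   diagonal only. *)
have cA : col_stable (iN m) A.
  apply: col_stableM => //; apply: col_stableM; first exact: col_stableV.
  move=> j; case: (split_ordP j) => k ->; last by rewrite (ord1 k) eqxx.
  move=> _; rewrite /G /mod_scalars /normal_gauge; set tr := \tr _ / _.
  rewrite [LHS]mxE [LHS]mxE [X in _ + X]mxE [X in _ - X]mxE block_mxEur !mxE.
  by rewrite eq_lrshift mulr0n oppr0 addr0 subrr.
(* Trace zero makes A its own representative modulo scalars. *)
have trA : \tr A = 0.
  rewrite /A mxtrace_mulC mulmxA mulmxV // mul1mx linearB /= /Y mxtrace_mulC mulmxA.
  by rewrite mulVmx // mul1mx tX /G tr_mod_scalars ?subrr // addn1.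
pose k (t : R) : MN := 1%:M + t *: A.
have sk : smoothat (0 : R) k by exact: smoothat_line.
have Hk : \forall t \near (0 : R), Ht (k t).
  apply: filterS (near_unit_line A) => t ut; apply/Ht_groupP; split => //.
    by apply: row_stableD; [exact: row_stable_scalar|exact: row_stableZ].
  by apply: col_stableD; [exact: col_stable_scalar|exact: col_stableZ].
have k0 : k 0 = 1%:M by rewrite /k scale0r addr0.
have [w4 w4E] : exists w : model (frames M),
    w = (0, derive1 (fun t => jet_mul (q.2 c) (H_jet (k t))) 0).
  exact: (ex_intro _ _ erefl).
have [|_ omw4] := om_vertical_curve Pq cq sk k0 _ w4E.
  by apply: filterS Hk => t Ht' _; exact: Ht_sub_H.
have vw4 : velocity Q (fun t => frame_act q (k t)) q c w4.
  rewrite w4E -(derive1_cst (mcoord c q.1) (0 : R)).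
  apply: frames_velocity; [|exact: cq|exact: smoothat_cst| |].
  - by rewrite k0 frame_act_scalar ?oner_neq0.
  - apply: smoothat_jet_mul; first exact: smoothat_cst.
    by apply: smoothat_H_jet; [rewrite k0; exact: H_group1|].
  - apply: filterS Hk => t Ht' _; split; [|exact: cq|exact: erefl|exact: erefl].
    exact: Qbundle_act.
exists (w3 + w4); first exact: velocityD_tangent vw3 vw4.
have omE := om_lin q c Pq cq 1 _ _
  (velocity_tangent (velocity_sub (Q_sub_P hs) vw3))
  (velocity_tangent (velocity_sub (Q_sub_P hs) vw4)).
rewrite !scale1r in omE.
(* Ad(h^-1) G + Ad(h^-1)(Y - G) = Ad(h^-1) Y = X. *)
rewrite omE omw3 omw4 derive1_line_id mod_scalars_tr0 // /A.
rewrite (mulmxBr _ Y G) mulmxBl addrC subrK /Y !mulmxA mulVmx // mul1mx.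
by rewrite -mulmxA mulVmx // mulmx1.
Qed.

End Connection.

Theorem proposition4p1 (R : realType) (m : nat) (hm : (2 <= m.+1)%N)
  (M : bmanifold R m) (s : M -> set (frames M))
  (hs : projective_structure s)
  (om : frames M -> chart (frames M) -> model (frames M) -> 'M[R]_(m.+1 + 1))
  (hom : normal_cartan_connection s om)
  (hPi : forall p : M, bd p ->
     exists c, [/\ boundary_chart c, mdom c p & Pi0_in_span_dr s c p]) :
  [/\ (forall (c : mchart M) (p : M),
         boundary_chart c -> mdom c p -> bd p -> Pi0_in_span_dr s c p),
      Qbundle s `<=` Pbundle s `&` @frame_base R m M @^-1` @bd R m M,
      cartan_geometry (@frame_base R m M) (@frame_act R m M) (@bd R m M)
        (Qbundle s) (Gt_group R m) (Ht_group R m) om &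
      ~ effective (Gt_group R m) (Ht_group R m)].
Proof.
have Pi0 c p : mdom c p -> bd p -> Pi0_in_span_dr s c p.
  move=> cp bp; have [c' [_ cp' pi]] := hPi p bp.
  exact: (Pi0_all hs cp' cp bp pi).
have QP := Q_sub_P hs.
split; last exact: Gt_Ht_not_effective.
- by move=> c p _; exact: Pi0.
- by move=> q /(Qbundle_P hs)[].
(* A curve in Q is a curve in P and H~ lies in H, so the axioms of a form, equivariance and
   fundamental fields restrict at once; bijectivity onto the smaller algebra does not. *)
have [[_ _ [of1 of2 of3] [eqv fund bij]] _] := hom.
split; first exact: Gt_Ht_klein_pair.
- exact: bd_principal_bundle.
- split.
  + move=> q gam c c' v v' Qq vv vv'.
    exact: of1 (QP _ Qq) (velocity_sub QP vv) (velocity_sub QP vv').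
  + move=> q c Qq cq a v w tv tw.
    by apply: of2; [exact: QP|exact: cq|exact: tangent_sub tv|exact: tangent_sub tw].
  + move=> q c Qq cq; have [ O [Om [oO Oq sO lO OE]]] := of3 q c (QP _ Qq) cq.
    exists O, Om; split => // q' Qq' cq' Oq' v tv.
    by apply: OE => //; [exact: QP|exact: tangent_sub tv].
split.
- move=> q h gam c v c' v' Qq Hh vv vv'.
  by apply: eqv (velocity_sub QP vv) (velocity_sub QP vv'); [exact: QP|exact: Ht_sub_H].
- move=> q h A c v Qq vh vv.
  by apply: fund (velocity_sub _ vh) (velocity_sub QP vv); [exact: QP|exact: Ht_sub_H].
- move=> q c Qq cq; have [maps inj _] := bij q c (QP _ Qq) cq; split.
  + move=> v tv; apply/lie_algebra_Gt; split.
      (* Trace-freeness is inherited from the values of [om] on vectors tangent to P. *)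
      by apply: (@lie_algebra_tr R m (PGL_group R m)); apply: maps; exact: tangent_sub tv.
    exact: (om_tangent_row_stable hs hom Pi0 Qq cq tv).
  + move=> v w; rewrite !inE => tv tw; apply: inj; rewrite inE;
      [exact: (tangent_sub QP tv)|exact: (tangent_sub QP tw)].
  + move=> X /lie_algebra_Gt [tX rX].
    by have [w tw omw] := om_tangent_surj hs hom Pi0 Qq cq tX rX; exists w.
Qed.
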